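(* Let $\theta$ be an irrational number of Diophantine type $\gamma(\theta)>2$ and let $T_0(x)=x+\theta \bmod 1$ be the rotation by $\theta$ on the circle $[0,1]/(0\sim1)$. Let $\rho$ be a probability density of bounded variation and let, for a nonsingular map $T$ of the circle, $L_{T,\rho}f=\rho\ast L_Tf$, where $\ast$ is the convolution on the circle. For $\delta\in[0,\overline\delta)$ let $D_\delta=\mathrm{Id}+\delta S$ be a bilipschitz homeomorphism of $[0,1]$, where $S$ is $1$-Lipschitz with $S(0)=S(1)=0$ and the support of $S$ is a finite union of intervals, let $T_\delta=D_\delta\circ T_0$, and let $f_\delta$ be fixed probability measures of $L_{T_\delta,\rho}$. Then Lebesgue measure $m$ is the stationary probability measure of $L_{T_0,\rho}$ and $$\lim_{\delta\to0}\frac{f_\delta-m}{\delta}=(\mathrm{Id}-L_{T_0,\rho})^{-1}\big[\rho\ast(-S)'\big]$$ with convergence in $L^1$.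
   Context: The Diophantine type of $\theta$ is $\gamma(\theta)=\inf\{\gamma:\exists c_0>0\text{ such that }\|k\theta\|\ge c_0|k|^{-\gamma}\ \forall k\in\mathbb Z\setminus\{0\}\}$, where $\|\cdot\|$ is the distance to the nearest integer. $L_T$ is the pushforward $L_T\mu(A)=\mu(T^{-1}A)$, absolutely continuous measures being identified with densities; $T$ nonsingular means that $L_T$ preserves absolutely continuous measures. $(\mathrm{Id}-L)^{-1}=\sum_{n\ge0}L^n$, acting on zero-average $L^1$ densities. *)

(* Defs.v *)
From HB Require Import structures.
From mathcomp Require Export all_boot all_order all_algebra.
From mathcomp Require Export all_classical all_reals all_analysis.

Set Implicit Arguments.
Unset Strict Implicit.
Unset Printing Implicit Defensive.

Export Order.TTheory GRing.Theory Num.Theory.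
Export numFieldNormedType.Exports.

Local Open Scope classical_set_scope.
Local Open Scope ring_scope.

(* The circle [0,1]/(0~1) is represented by its fundamental domain [0,1[.
   A function on the circle is a function R -> R of which only the values on
   [0,1[ matter; a measure on the circle is a Borel measure on R carried by
   [0,1[. *)

Section circle.
Context {R : realType}.

Definition circle : set R := `[0, 1[%classic.

(* Projection of the real line onto the circle: the fractional part. *)
Definition circle_proj (x : R) : R := x - (Num.floor x)%:~R.

Local Notation leb := (@lebesgue_measure R).

Lemma measurable_circle : measurable circle.
Proof. exact: measurable_itv. Qed.

Definition circle_leb : {measure set (measurableTypeR R) -> \bar R} :=
  mrestr leb measurable_circle.

Definition circle_probability
    (mu : {measure set (measurableTypeR R) -> \bar R}) : Prop :=
  mu [set: R] = 1%E /\ mu (~` circle) = 0%E.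

Definition probability_density (rho : R -> R) : Prop :=
  [/\ measurable_fun circle rho,
      (forall x, circle x -> 0 <= rho x) &
      (\int[leb]_(x in circle) (rho x)%:E = 1)%E].

Definition L1 (g : R -> R) : Prop := leb.-integrable circle (EFin \o g).

Definition L1norm (g : R -> R) : \bar R :=
  (\int[leb]_(x in circle) (`|g x|)%:E)%E.

Definition is_density (nu : set (measurableTypeR R) -> \bar R) (g : R -> R) :
    Prop :=
  L1 g /\ forall A : set (measurableTypeR R), measurable A -> A `<=` circle ->
    nu A = (\int[leb]_(x in A) (g x)%:E)%E.

(* A version of the Radon-Nikodym density with respect to the Lebesgue measure
   of the circle, for set functions nu that need not be bundled as (signed)
   measures; it is 0 by convention if nu has no integrable density. *)
Definition density (nu : set (measurableTypeR R) -> \bar R) : R -> R :=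
  xget (cst 0) (is_density nu).

(* L_T on densities: the density of the pushforward by T of the signed measure
   of density f. It exists as soon as T is nonsingular and f is integrable. *)
Definition transfer (T f : R -> R) : R -> R :=
  density (pushforward
    (fun A : set (measurableTypeR R) =>
       (\int[leb]_(x in circle `&` A) (f x)%:E)%E)
    (T : measurableTypeR R -> measurableTypeR R)).

(* Convolution on the circle of rho with a density f, and with a positive
   measure nu (which yields a density). *)
Definition conv (rho f : R -> R) (x : R) : R :=
  \int[leb]_(y in circle) (rho (circle_proj (x - y)) * f y).

Definition conv_measure (rho : R -> R)
    (nu : set (measurableTypeR R) -> \bar R) (x : R) : R :=
  fine (\int[nu]_(y in circle) (rho (circle_proj (x - y)))%:E)%E.

(* L_{T,rho} on densities; on measures it maps mu to the measure of density
   rho * (T_* mu), which is the operator whose fixed points are the stationary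
   measures. *)
Definition noisy_transfer (T rho f : R -> R) : R -> R :=
  conv rho (transfer T f).

Definition stationary (T rho : R -> R)
    (mu : {measure set (measurableTypeR R) -> \bar R}) : Prop :=
  forall A : set (measurableTypeR R), measurable A ->
    mu A = (\int[leb]_(x in circle `&` A)
      (conv_measure rho
        (pushforward mu (T : measurableTypeR R -> measurableTypeR R)) x)%:E)%E.

(* h = (Id - L)^{-1} g, i.e. g is a zero-average L^1 density and the series
   \sum_n L^n g converges to h in L^1; this determines h almost everywhere. *)
Definition is_resolvent (L : (R -> R) -> (R -> R)) (g h : R -> R) : Prop :=
  [/\ L1 g, \int[leb]_(x in circle) g x = 0, L1 h &
      L1norm (fun x => \sum_(0 <= k < n) iter k L g x - h x) @[n --> \oo]
        --> 0%E].

Definition dist_int (x : R) : R := inf [set `|x - n%:~R| | n in [set: int]].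

(* The infimum is taken in \bar R: it is +oo when no exponent is admissible
   (Liouville numbers). *)
Definition diophantine_type (theta : R) : \bar R :=
  ereal_inf [set gamma%:E | gamma in
    [set gamma : R | exists2 c0 : R, 0 < c0 & forall k : int, k != 0 ->
      c0 * (`|k%:~R| `^ (- gamma)) <= dist_int (k%:~R * theta)]].

Definition rotation (theta x : R) : R := circle_proj (x + theta).

Definition bilipschitz_homeomorphism (D : R -> R) : Prop :=
  set_bij `[0, 1] `[0, 1] D /\
  exists c C : R, 0 < c /\ forall x y, x \in `[0, 1] -> y \in `[0, 1] ->
    c * `|x - y| <= `|D x - D y| <= C * `|x - y|.

Definition support_finite_union_itv (S : R -> R) : Prop :=
  exists s : seq (interval R),
    closure [set x | x \in `[0, 1] /\ S x != 0] =
    \big[setU/set0]_(i <- s) [set` i].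

(* D_delta = Id + delta S and T_delta = D_delta o T_0; since D_delta fixes 0
   and 1, it maps [0,1[ to itself. *)
Definition perturbation (S : R -> R) (delta x : R) : R := x + delta * S x.

Definition perturbed_rotation (theta : R) (S : R -> R) (delta : R) : R -> R :=
  perturbation S delta \o rotation theta.

End circle.

(* Main.v *)
Require Import Defs.
From HB Require Import structures.
From mathcomp Require Import ring lra measurable_realfun.

(** The density [rho] may jump, so the kernel [r] can be neither differentiated nor compared
    pointwise at nearby points. Two devices replace this. A monotone [P] dominates the increments of
    [r], so that a displacement of the argument by at most [d] costs [2 * d * V] after integration,
    whatever its shape; and the derivative is carried by [S], through the change of variables. The
    crude bound [g - 1 = O(delta)] has to come first: the kernels [r (x - D y)] and [r (x - y)]
    differ by [O(delta)] in mean, so replacing [g] by [1] in [g - L g] then costs only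
    [O(delta ^ 2)], which survives the division by [delta]. All estimates are made in the sup norm,
    on functions defined everywhere. Convolutions allow this, since they do not see negligible sets;
    almost everywhere statements are confined to [transfer], [density] and the derivative of [S]. *)

(* Writing [r] for the periodic extension of [rho] and [rt] for its translate
   by [theta], the operator [L_{T_0, rho}] is the convolution [L] with [rt]. As
   [rho] has bounded variation, it is bounded below by a positive constant on an
   interval, so that some iterate of [L] satisfies a Doeblin condition and
   contracts the zero-average bounded functions in the sup norm. This yields the
   uniqueness of the stationary measure, the uniform convergence of the Neumann
   series, and a bound [sup |w| <= K * sup |w - L w|] for zero-average [w].
   The density [g] of [f delta] is bounded by the fixed point equation, and the
   bounded variation of [rho] gives [g - L g = O(delta)], hence
   [g - 1 = O(delta)], uniformly. Since [S] is Lipschitz, it is almost everywhere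
   differentiable and the change of variables by [D = id + delta S], whose
   derivative is [1 + delta S'], turns [int (r (x - D y) - r (x - y)) dy] into
   [- delta int r (x - D y) S' y dy]. Thus [(g - L g) / delta] is
   [O(delta)]-close to [rho * (- S')], and the bound above, applied to
   [(g - 1) / delta - h], concludes with the rate [O(delta)]. *)

Set Implicit Arguments.
Unset Strict Implicit.
Unset Printing Implicit Defensive.

Local Open Scope classical_set_scope.
Local Open Scope ring_scope.

(** * Integrals of periodic functions *)

Section periodic_integral.
Context {R : realType}.
Local Notation leb := (@lebesgue_measure R).
Local Notation mT := (measurableTypeR R).

Lemma measurable_addr (c : R) :
  measurable_fun [set: R] (fun x : R => x + c).
Proof. exact: measurable_funD. Qed.

Lemma preimage_addr_itv (a b c : R) (x y : bool) :
  (fun t : R => t + c) @^-1` [set` Interval (BSide x a) (BSide y b)] =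
  [set` Interval (BSide x (a - c)) (BSide y (b - c))].
Proof.
by apply/seteqP; split => t; case: x; case: y => /=; rewrite !in_itv /=; lra.
Qed.

Lemma lebesgue_measure_addr (c : R) (A : set R) : measurable A ->
  pushforward leb ((fun x => x + c) : mT -> mT) A = leb A.
Proof.
move=> mA; apply/esym/lebesgue_measure_unique => //=; first exact: measurable_addr.
move=> ? _ [[a b]] _ <-.
rewrite /pushforward preimage_addr_itv/= !lebesgue_measure_itv/=.
rewrite !lte_fin ltrD2r -!EFinB; have -> : (b - c - (a - c) = b - a)%R by ring.
by []. Qed.

Lemma integral_addr (F : R -> \bar R) (c : R) (D : set R) : measurable D ->
  measurable_fun [set: R] F ->
  (\int[leb]_(x in (fun x => x + c)%R @^-1` D) F (x + c)%R =
   \int[leb]_(x in D) F x)%E.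
Proof.
move=> mD mF; wlog F0 : F mF / forall x, (0 <= F x)%E.
  move=> H; rewrite integralE [RHS]integralE.
  have mp : measurable_fun [set: R] (F^\+)%E by exact: measurable_funepos.
  have mn : measurable_fun [set: R] (F^\-)%E by exact: measurable_funeneg.
  have ep := H (F^\+)%E mp (fun x => funepos_ge0 F x).
  have en := H (F^\-)%E mn (fun x => funeneg_ge0 F x).
  rewrite -[X in _ = (X - _)%E]ep -[X in _ = (_ - X)%E]en.
  by congr (_ - _)%E; apply: eq_integral => x _; rewrite ?funeposE ?funenegE.
have := @ge0_integral_pushforward _ _ mT mT R (fun x => x + c)
  (measurable_addr c) leb D F mD (measurable_funS measurableT (@subsetT _ D) mF).
move=> /(_ (fun x _ => F0 x)); rewrite /comp => <-.
apply: eq_measure_integral => [|? A mA _]; first exact: measurable_addr.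
  exact: lebesgue_measure_addr.
Qed.

Lemma integral_opp (F : R -> \bar R) (D : set R) : measurable D ->
  measurable_fun [set: R] F ->
  (\int[leb]_(x in -%R @^-1` D) F (- x)%R = \int[leb]_(x in D) F x)%E.
Proof.
move=> mD mF; wlog F0 : F mF / forall x, (0 <= F x)%E.
  move=> H; rewrite integralE [RHS]integralE.
  have mp : measurable_fun [set: R] (F^\+)%E by exact: measurable_funepos.
  have mn : measurable_fun [set: R] (F^\-)%E by exact: measurable_funeneg.
  have ep := H (F^\+)%E mp (fun x => funepos_ge0 F x).
  have en := H (F^\-)%E mn (fun x => funeneg_ge0 F x).
  rewrite -[X in _ = (X - _)%E]ep -[X in _ = (_ - X)%E]en.
  by congr (_ - _)%E; apply: eq_integral => x _; rewrite ?funeposE ?funenegE.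
have mN : measurable_fun [set: mT] (-%R : mT -> mT) by exact: measurable_funN.
have := @ge0_integral_pushforward _ _ mT mT R -%R mN leb D F mD
  (measurable_funS measurableT (@subsetT _ D) mF).
move=> /(_ (fun x _ => F0 x)); rewrite /comp => <-.
apply: eq_measure_integral => A mA _.
  exact: lebesgue_measureN.
Qed.

Lemma periodicDz (T : Type) (F : R -> T) : (forall x, F (x + 1) = F x) ->
  forall (n : int) x, F (x + n%:~R) = F x.
Proof.
move=> F1; have FN n x : F (x + n%:R) = F x.
  by elim: n x => [|n IH] x; rewrite ?addr0// -addn1 natrD addrA F1 IH.
move=> [n|n] x; first exact: FN.
by rewrite NegzE mulrNz -[LHS](FN n.+1) addrNK.
Qed.

Lemma periodic_proj (T : Type) (F : R -> T) : (forall x, F (x + 1) = F x) ->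
  forall x, F (circle_proj x) = F x.
Proof. by move=> F1 x; rewrite /circle_proj -mulrNz periodicDz. Qed.

Lemma circle_projP (x : R) : circle (circle_proj x).
Proof.
rewrite /circle/= in_itv/= /circle_proj subr_ge0 Num.Theory.floor_le/=.
by rewrite ltrBlDr addrC; have := Num.Theory.floorD1_gt x; rewrite intrD.
Qed.

Lemma circle_proj_id (x : R) : circle x -> circle_proj x = x.
Proof.
rewrite /circle/= in_itv/= => /andP[x0 x1].
by rewrite /circle_proj (@Num.Theory.floor_def _ x 0) ?subr0// x0 x1.
Qed.

Lemma circle_projDz (x : R) (n : int) : circle_proj (x + n%:~R) = circle_proj x.
Proof.
rewrite /circle_proj Num.Theory.floorDrz ?intr_int//.
by rewrite Num.Theory.intrKfloor intrD opprD addrACA subrr addr0.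
Qed.

Lemma circle_projD1 (x : R) : circle_proj (x + 1) = circle_proj x.
Proof. exact: (circle_projDz x 1). Qed.

Lemma measurable_circle_proj : measurable_fun [set: R] (@circle_proj R).
Proof.
apply: measurable_funB => //; apply: nondecreasing_measurable => // x y xy.
by rewrite ler_int; exact: Num.Theory.le_floor.
Qed.

Section periodic.
Variables (F : R -> \bar R) (mF : measurable_fun [set: R] F).
Hypothesis F1 : forall x, F (x + 1) = F x.

Lemma integral_itv_shift (a b c : R) :
  (\int[leb]_(x in `[a, b[) F (x + c)%R =
   \int[leb]_(x in `[(a + c)%R, (b + c)%R[) F x)%E.
Proof. by rewrite -(@integral_addr F c)//= preimage_addr_itv !addrK. Qed.

(** An integer translation brings the left end of the window to some [s] in [[0, 1[]; the piece [[1,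
    s + 1[] is then moved back to [[0, s[]. *)
Lemma periodic_integral_window (c : R) :
  (\int[leb]_(x in `[c, (c + 1)%R[) F x = \int[leb]_(x in circle) F x)%E.
Proof.
have H (s : R) (n : int) : (\int[leb]_(x in `[(s + n%:~R)%R, (s + n%:~R + 1)%R[) F x =
     \int[leb]_(x in `[s, (s + 1)%R[) F x)%E.
  rewrite addrAC -integral_itv_shift; apply: eq_integral => x _.
  exact: periodicDz.
have cE : c = circle_proj c + (Num.floor c)%:~R by rewrite /circle_proj subrK.
rewrite cE H; have := circle_projP c; rewrite /circle/= in_itv/=.
move: (circle_proj c) => {H cE} s /andP[s0 s1].
have split (u v w : R) : u <= v <= w ->
   (\int[leb]_(x in `[u, w[) F x =
    \int[leb]_(x in `[u, v[) F x + \int[leb]_(x in `[v, w[) F x)%E.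
  move=> /andP[uv vw]; rewrite -integral_setU//.
  - by congr integral; apply/seteqP; split => x /=; rewrite !in_itv/=; lra.
  - exact: measurable_funS mF.
  - apply/disj_setPS => x /=; rewrite !in_itv/=; lra.
rewrite (split _ 1); last by lra.
rewrite [X in (_ + X)%E](_ : _ = \int[leb]_(x in `[0%R, s[) F x)%E; last first.
  rewrite -{1}(add0r 1) -integral_itv_shift.
  by apply: eq_integral => x _; rewrite F1.
by rewrite /circle (split 0 s 1) ?s0 ?(ltW s1)// addeC.
Qed.

Lemma periodic_integralD (c : R) :
  (\int[leb]_(x in circle) F (x + c)%R = \int[leb]_(x in circle) F x)%E.
Proof.
by rewrite integral_itv_shift add0r [(1 + c)%R]addrC periodic_integral_window.
Qed.

End periodic.

Lemma periodic_integralN (F : R -> \bar R) (c : R) :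
  measurable_fun [set: R] F -> (forall x, F (x + 1) = F x) ->
  (\int[leb]_(x in circle) F (c - x)%R = \int[leb]_(x in circle) F x)%E.
Proof.
move=> mF F1.
have mFN : measurable_fun [set: R] (fun x => F (- x)%R) by exact: measurableT_comp.
transitivity (\int[leb]_(x in circle) F (- x)%R)%E.
  rewrite -(@periodic_integralD (fun x => F (- x)%R) _ _ (- c))//.
    by apply: eq_integral => x _; rewrite opprD opprK addrC.
  by move=> x; rewrite -[LHS]F1; congr F; ring.
(* Reflection maps [[-1, 0[] onto []0, 1]], which differs from the circle only by endpoints. *)
rewrite -(periodic_integral_window mF F1 (-1)) addNr.
rewrite -(@integral_opp F)// opp_preimage_itvbndbnd/= opprK oppr0.
have m1 (D : set R) : measurable_fun D (fun x => F (- x)%R).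
  exact: measurable_funS mFN.
by rewrite (integral_itv_bndoo _ _ (m1 _)) [RHS](integral_itv_bndoo _ _ (m1 _)).
Qed.

End periodic_integral.

(** * Convolution with a kernel of bounded variation *)

Section bounded_functions.
Context {R : realType}.
Local Notation leb := (@lebesgue_measure R).
Implicit Types (f g w : R -> R) (A B : R).

Lemma lebesgue_circle : leb (@circle R) = 1%E.
Proof. by rewrite /circle lebesgue_measure_itv/= lte_fin ltr01 oppr0 adde0. Qed.

(** The bound holds at every point, so that genuine suprema and pointwise limits can be used instead
    of essential ones. *)
Definition bmf B f := measurable_fun (@circle R) f /\
  forall x, circle x -> `|f x| <= B.

Lemma bmf_integrable B f : bmf B f -> L1 f.
Proof.
move=> [mf fB]; apply: measurable_bounded_integrable => //.
- exact: measurable_circle.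
- by rewrite [X in (X < _)%E]lebesgue_circle ltry.
- exists B; split; first exact: num_real.
  by move=> x Bx y /= cy; rewrite (le_trans (fB _ cy))// ltW.
Qed.

Lemma bmfW B B' f : B <= B' -> bmf B f -> bmf B' f.
Proof. by move=> BB' [mf fB]; split => // x cx; rewrite (le_trans (fB _ cx)). Qed.

Lemma bmf_ge0 B f : bmf B f -> 0 <= B.
Proof.
have c0 : circle (0 : R) by rewrite /circle/= in_itv/= lexx ltr01.
by move=> [_ /(_ _ c0)]; exact: le_trans.
Qed.

Lemma bmf_cst a : bmf `|a| (cst a).
Proof. by split. Qed.

Lemma bmfD A B f g : bmf A f -> bmf B g -> bmf (A + B) (fun x => f x + g x).
Proof.
move=> [mf fA] [mg gB]; split; first exact: measurable_funD.
by move=> x cx; rewrite (le_trans (ler_normD _ _))// lerD ?fA ?gB.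
Qed.

Lemma bmfN B f : bmf B f -> bmf B (fun x => - f x).
Proof.
move=> [mf fB]; split; first exact: measurableT_comp.
by move=> x cx; rewrite normrN fB.
Qed.

Lemma bmfB A B f g : bmf A f -> bmf B g -> bmf (A + B) (fun x => f x - g x).
Proof. by move=> fA /bmfN gB; exact: bmfD fA gB. Qed.

Lemma bmfM A B f g : bmf A f -> bmf B g -> bmf (A * B) (fun x => f x * g x).
Proof.
move=> fA gB; have [A0 B0] := (bmf_ge0 fA, bmf_ge0 gB).
move: fA gB => [mf fA] [mg gB]; split; first exact: measurable_funM.
by move=> x cx; rewrite normrM ler_pM ?fA ?gB.
Qed.

Lemma Rintegral_circle_cst a : \int[leb]_(x in circle) a = a :> R.
Proof.
rewrite Rintegral_cst; last exact: measurable_circle.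
by rewrite [X in fine X]lebesgue_circle mulr1.
Qed.

Lemma bmf_Rintegral_le B f : bmf B f -> `|\int[leb]_(x in circle) f x| <= B.
Proof.
move=> fB; have If := bmf_integrable fB.
rewrite (le_trans (le_normr_Rintegral _ If))//; first exact: measurable_circle.
rewrite -[leRHS]Rintegral_circle_cst le_Rintegral//.
- exact: measurable_circle.
- exact: integrable_norm.
- exact: (bmf_integrable (bmf_cst B)).
- by case: fB.
Qed.

Lemma eq_RintegralP (D : set R) f g : (forall x, D x -> f x = g x) ->
  \int[leb]_(x in D) f x = \int[leb]_(x in D) g x.
Proof. by move=> fg; apply: eq_Rintegral => x /set_mem /fg. Qed.

Lemma periodic_RintegralD f (c : R) : measurable_fun [set: R] f ->
  (forall x, f (x + 1) = f x) ->
  \int[leb]_(x in circle) f (x + c) = \int[leb]_(x in circle) f x.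
Proof.
move=> mf f1; congr fine.
rewrite -(@periodic_integralD _ (EFin \o f) _ _ c)//.
- exact/measurable_EFinP.
- by move=> x /=; rewrite f1.
Qed.

Lemma periodic_RintegralN f (c : R) : measurable_fun [set: R] f ->
  (forall x, f (x + 1) = f x) ->
  \int[leb]_(x in circle) f (c - x) = \int[leb]_(x in circle) f x.
Proof.
move=> mf f1; congr fine.
rewrite -(@periodic_integralN _ (EFin \o f) c)//.
- exact/measurable_EFinP.
- by move=> x /=; rewrite f1.
Qed.

Lemma RintegralBc A B f g : bmf A f -> bmf B g ->
  \int[leb]_(x in circle) (f x - g x) =
  \int[leb]_(x in circle) f x - \int[leb]_(x in circle) g x.
Proof.
move=> /bmf_integrable fA /bmf_integrable gB; rewrite RintegralB//.
exact: measurable_circle.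
Qed.

Lemma RintegralDc A B f g : bmf A f -> bmf B g ->
  \int[leb]_(x in circle) (f x + g x) =
  \int[leb]_(x in circle) f x + \int[leb]_(x in circle) g x.
Proof.
move=> /bmf_integrable fA /bmf_integrable gB; rewrite RintegralD//.
exact: measurable_circle.
Qed.

Lemma RintegralZc a B f : bmf B f ->
  \int[leb]_(x in circle) (a * f x) = a * \int[leb]_(x in circle) f x.
Proof.
move=> /bmf_integrable fB; rewrite RintegralZl//; exact: measurable_circle.
Qed.

Lemma le_Rintegralc A B f g : bmf A f -> bmf B g ->
  (forall x, circle x -> f x <= g x) ->
  \int[leb]_(x in circle) f x <= \int[leb]_(x in circle) g x.
Proof.
move=> /bmf_integrable fA /bmf_integrable gB fg; apply: le_Rintegral => //.
exact: measurable_circle.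
Qed.

End bounded_functions.

Section kernel.
Context {R : realType}.
Local Notation leb := (@lebesgue_measure R).

Definition cconv (k w : R -> R) (x : R) : R :=
  \int[leb]_(y in circle) (k (x - y) * w y).

(* [P] plays the role of the variation function of [r], and [V] of its
   variation over one period. *)
Record noise_kernel (r : R -> R) (M : R) (P : R -> R) (V : R) : Prop := {
  nk_measurable : measurable_fun [set: R] r ;
  nk_periodic : forall x, r (x + 1) = r x ;
  nk_ge0 : forall x, 0 <= r x ;
  nk_le : forall x, r x <= M ;
  nk_int : \int[leb]_(x in circle) r x = 1 ;
  nk_var : forall a b, a <= b -> `|r b - r a| <= P b - P a ;
  nk_varD1 : forall x, P (x + 1) = P x + V }.

Variables (r : R -> R) (M : R) (P : R -> R) (V : R).
Hypothesis nk : noise_kernel r M P V.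

Lemma nk_nd : {homo P : a b / a <= b}.
Proof.
by move=> a b /(nk_var nk) ab; rewrite -subr_ge0; exact: le_trans ab.
Qed.

Lemma nk_V_ge0 : 0 <= V.
Proof.
have : P 0 <= P (0 + 1) by apply: nk_nd; rewrite add0r.
by rewrite (nk_varD1 nk) lerDl.
Qed.

Lemma nk_M_ge0 : 0 <= M.
Proof. exact: le_trans (nk_ge0 nk 0) (nk_le nk 0). Qed.

Lemma nk_measurable_P : measurable_fun [set: R] P.
Proof. by apply: nondecreasing_measurable => //; exact: nk_nd. Qed.

Lemma bmf_kernel (u : R -> R) : measurable_fun (@circle R) u ->
  bmf M (fun y => r (u y)).
Proof.
move=> mu; split; first exact: measurableT_comp (nk_measurable nk) mu.
by move=> x _; rewrite ger0_norm ?(nk_ge0 nk)// (nk_le nk).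
Qed.

Lemma measurable_subl (D : set R) (x : R) : measurable_fun D (fun y : R => x - y).
Proof. exact: measurable_funB. Qed.

Lemma kernel_int (x : R) : \int[leb]_(y in circle) r (x - y) = 1.
Proof.
rewrite periodic_RintegralN ?(nk_int nk)//.
- exact: nk_measurable nk.
- exact: nk_periodic nk.
Qed.

(* [P - V id] is periodic, so a translation by [s] adds exactly [s V] to the
   integral of [P] over a period. *)
Lemma variation_int (x s : R) : 0 <= s ->
  \int[leb]_(y in circle) (P (x - y + s) - P (x - y - s)) = 2 * s * V.
Proof.
move=> s0.
pose Q y := P y - V * y.
have mQ : measurable_fun [set: R] Q.
  by apply: measurable_funB; [exact: nk_measurable_P|exact: measurable_funM].
have Q1 y : Q (y + 1) = Q y by rewrite /Q (nk_varD1 nk); ring.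
have V0 := nk_V_ge0.
have QB y : `|Q y| <= `|P 0| + `|P 1| + V.
  rewrite -(periodic_proj Q1); have := circle_projP y.
  rewrite /circle/= in_itv/=; move: (circle_proj y) => z /andP[z0 z1].
  have := nk_nd z0; have := nk_nd (ltW z1) => Pz1 P0z.
  have Vz0 : 0 <= V * z by rewrite mulr_ge0.
  have VzV : V * z <= V by apply: ler_piMr => //; exact: ltW.
  have := ler_norm (P 0); have := ler_norm (P 1).
  have := ler_norm (- P 0); have := ler_norm (- P 1); rewrite !normrN => *.
  by rewrite ler_norml /Q; lra.
have bQ c : bmf (`|P 0| + `|P 1| + V) (fun y => Q (x - y + c)).
  split => // ; apply: measurableT_comp mQ _; apply: measurable_funD => //.
  exact: measurable_subl.
have iQ c : \int[leb]_(y in circle) Q (x - y + c) = \int[leb]_(y in circle) Q y.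
  rewrite -(@periodic_RintegralN _ Q (x + c))//.
  by apply: eq_RintegralP => y _; congr Q; ring.
transitivity (\int[leb]_(y in circle)
   ((Q (x - y + s) - Q (x - y - s)) + 2 * s * V)).
  by apply: eq_RintegralP => y _; rewrite /Q /=; move: (P _) (P _) => p q; ring.
rewrite (RintegralDc (bmfB (bQ _) (bQ _)) (bmf_cst _)).
by rewrite (RintegralBc (bQ _) (bQ _)) !iQ Rintegral_circle_cst subrr add0r.
Qed.

(** Both [u y] and [v y] lie in [[x - y - d, x - y + d]], so the increment of [P] over this interval
    bounds [r (u y) - r (v y)], and its integral is [2 * d * V]. This serves for translations of the
    kernel as well as for the perturbation [D]. *)
Lemma kernel_close (x d B : R) (u v w : R -> R) : 0 <= d ->
  measurable_fun (@circle R) u -> measurable_fun (@circle R) v ->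
  (forall y, circle y -> `|u y - (x - y)| <= d) ->
  (forall y, circle y -> `|v y - (x - y)| <= d) ->
  bmf B w ->
  `|\int[leb]_(y in circle) (r (u y) * w y) -
    \int[leb]_(y in circle) (r (v y) * w y)| <= 2 * d * V * B.
Proof.
move=> d0 mu mv ud vd wB; have B0 := bmf_ge0 wB.
have [bu bv] := (bmf_kernel mu, bmf_kernel mv).
rewrite -(RintegralBc (bmfM bu wB) (bmfM bv wB)).
have bD := bmfB (bmfM bu wB) (bmfM bv wB).
apply: le_trans (le_normr_Rintegral _ (bmf_integrable bD)) _.
  exact: measurable_circle.
have mP (c : R) : measurable_fun (@circle R) (fun y => P (x - y + c)).
  apply: measurableT_comp nk_measurable_P _; apply: measurable_funD => //.
  exact: measurable_subl.
have bP c : bmf (`|P (x + c)| + `|P (x - 1 + c)|) (fun y => P (x - y + c)).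
  split => // y; rewrite /circle/= in_itv/= => /andP[y0 y1].
  have H1 : P (x - y + c) <= P (x + c) by apply: nk_nd; lra.
  have H2 : P (x - 1 + c) <= P (x - y + c) by apply: nk_nd; lra.
  have := ler_norm (P (x + c)); have := ler_norm (- P (x - 1 + c)).
  have := normr_ge0 (P (x + c)); have := normr_ge0 (P (x - 1 + c)).
  by rewrite normrN ler_norml; lra.
rewrite -(variation_int x d0) mulrC -(RintegralZc _ (bmfB (bP _) (bP _))).
have bn : bmf (M * B + M * B) (fun y => `|r (u y) * w y - r (v y) * w y|).
  case: bD => mD hD; split; first exact: measurableT_comp.
  by move=> y cy; rewrite normr_id hD.
apply: (le_Rintegralc bn (bmfM (bmf_cst B) (bmfB (bP _) (bP _)))) => y cy /=.
rewrite -mulrBl normrM mulrC ler_pM//; first by case: wB => _; exact.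
move: (vd _ cy) (ud _ cy); rewrite !(ler_norml _ d) => /andP[v1 v2] /andP[u1 u2].
have [Pu1 Pu2] : P (x - y - d) <= P (u y) /\ P (u y) <= P (x - y + d).
  by split; apply: nk_nd; lra.
have [Pv1 Pv2] : P (x - y - d) <= P (v y) /\ P (v y) <= P (x - y + d).
  by split; apply: nk_nd; lra.
have [uv|/ltW vu] := leP (u y) (v y).
  by rewrite distrC (le_trans (nk_var nk uv))//; lra.
by rewrite (le_trans (nk_var nk vu))//; lra.
Qed.

(** The regularity comes from the kernel alone; it yields continuity, hence measurability, of
    [cconv r w]. *)
Lemma cconv_lipschitz (B : R) (w : R -> R) (x x' : R) : bmf B w ->
  `|cconv r w x - cconv r w x'| <= 2 * V * B * `|x - x'|.
Proof.
move=> wB; have := @kernel_close x `|x - x'| B (fun y => x - y) (fun y => x' - y) w.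
rewrite /cconv => /(_ (normr_ge0 _) (measurable_subl _) (measurable_subl _)).
have -> : 2 * `|x - x'| * V * B = 2 * V * B * `|x - x'| by ring.
apply => // y _; first by rewrite subrr normr0.
by rewrite (_ : _ - _ = - (x - x')) ?normrN//; ring.
Qed.

Lemma measurable_cconv (B : R) (w : R -> R) : bmf B w ->
  measurable_fun [set: R] (cconv r w).
Proof.
move=> wB; apply: continuous_measurable_fun => x.
apply/cvgrPdist_lt => e e0 /=.
(* The added [1] keeps [K] positive when [V] or [B] vanishes. *)
pose K := 2 * V * B + 1.
have K0 : 0 < K.
  by rewrite ltr_wpDl// !mulr_ge0 ?nk_V_ge0// (bmf_ge0 wB).
near=> y.
rewrite (le_lt_trans (cconv_lipschitz _ _ wB))//.
apply: (@le_lt_trans _ _ (K * `|x - y|)).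
  by rewrite ler_wpM2r// lerDl.
by rewrite mulrC -ltr_pdivlMr//; near: y; apply: cvgr_dist_lt => //; exact: divr_gt0.
Unshelve. all: by end_near. Qed.

Lemma cconv_bound (B : R) (w : R -> R) (x : R) : bmf B w -> `|cconv r w x| <= B.
Proof.
move=> wB; have B0 := bmf_ge0 wB.
have bk : bmf M (fun y => r (x - y)) by exact: bmf_kernel (measurable_subl _).
have bD := bmfM bk wB.
apply: le_trans (le_normr_Rintegral _ (bmf_integrable bD)) _.
  exact: measurable_circle.
rewrite -[leRHS]mulr1 -(kernel_int x) -(RintegralZc _ bk).
have bn : bmf (M * B) (fun y => `|r (x - y) * w y|).
  case: bD => mD hD; split; first exact: measurableT_comp.
  by move=> y cy; rewrite normr_id hD.
apply: (le_Rintegralc bn (bmfM (bmf_cst B) bk)) => y cy /=.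
rewrite normrM mulrC (ger0_norm (nk_ge0 nk _)) ler_wpM2r// ?(nk_ge0 nk)//.
by case: wB => _; exact.
Qed.

Lemma bmf_cconv (B : R) (w : R -> R) : bmf B w -> bmf B (cconv r w).
Proof.
move=> wB; split; last by move=> x _; exact: cconv_bound.
by apply: measurable_funTS; exact: measurable_cconv wB.
Qed.

Lemma cconv_periodic (w : R -> R) (x : R) : cconv r w (x + 1) = cconv r w x.
Proof.
by apply: eq_RintegralP => y _; rewrite addrAC (nk_periodic nk).
Qed.

Lemma cconv_cst (a x : R) : cconv r (cst a) x = a.
Proof.
rewrite /cconv; under eq_Rintegral do rewrite mulrC.
have bk : bmf M (fun y => r (x - y)) by exact: bmf_kernel (measurable_subl _).
by rewrite (RintegralZc _ bk) kernel_int mulr1.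
Qed.

Lemma cconvD (A B : R) (v w : R -> R) (x : R) : bmf A v -> bmf B w ->
  cconv r (fun y => v y + w y) x = cconv r v x + cconv r w x.
Proof.
move=> vA wB; rewrite /cconv.
have bk : bmf M (fun y => r (x - y)) by exact: bmf_kernel (measurable_subl _).
rewrite -(RintegralDc (bmfM bk vA) (bmfM bk wB)).
by apply: eq_RintegralP => y _; rewrite mulrDr.
Qed.

Lemma cconvZ (a B : R) (w : R -> R) (x : R) : bmf B w ->
  cconv r (fun y => a * w y) x = a * cconv r w x.
Proof.
move=> wB; rewrite /cconv.
have bk : bmf M (fun y => r (x - y)) by exact: bmf_kernel (measurable_subl _).
rewrite -(RintegralZc _ (bmfM bk wB)).
by apply: eq_RintegralP => y _; ring.
Qed.

Lemma cconvB (A B : R) (v w : R -> R) (x : R) : bmf A v -> bmf B w ->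
  cconv r (fun y => v y - w y) x = cconv r v x - cconv r w x.
Proof.
move=> vA wB; rewrite -mulN1r -(cconvZ _ _ wB) -(cconvD _ vA (bmfM (bmf_cst (-1)) wB)).
by apply: eq_RintegralP => y _; rewrite mulN1r.
Qed.

End kernel.

(** * Conservation of the mean and a lower bound for the kernel *)

Section mixing.
Context {R : realType}.
Local Notation leb := (@lebesgue_measure R).
Variables (r : R -> R) (M : R) (P : R -> R) (V : R).
Hypothesis nk : noise_kernel r M P V.

Local Notation L := (cconv r).

Lemma EFin_Rintegral (D : set R) (f : R -> R) : leb.-integrable D (EFin \o f) ->
  measurable D -> (\int[leb]_(x in D) f x)%:E = (\int[leb]_(x in D) (f x)%:E)%E.
Proof. by move=> If mD; rewrite fineK//; exact: integrable_fin_num. Qed.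

(** Tonelli, as every translate of the kernel has integral [1]. Nonnegativity is obtained by adding
    to [w] the constant [B], which [L] fixes. *)
Lemma cconv_mean (B : R) (w : R -> R) : bmf B w ->
  \int[leb]_(x in circle) L w x = \int[leb]_(x in circle) w x.
Proof.
wlog w0 : B w / (forall y, circle y -> 0 <= w y).
  move=> H wB; have bc : bmf B (cst B : R -> R).
    by rewrite -{1}(ger0_norm (bmf_ge0 wB)); exact: bmf_cst.
  have bw := bmfD wB bc.
  have := H _ _ _ bw; have -> : L (fun x => w x + B) = (fun x => L w x + B).
    by apply/funext => x; rewrite -[in RHS](cconv_cst nk B x) -(cconvD nk _ wB bc).
  rewrite (RintegralDc (bmf_cconv nk wB) bc) (RintegralDc wB bc) => H'.
  apply: (addIr (\int[leb]_(x in circle) cst B x)); apply: H' => y cy.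
  by rewrite -lerBlDr sub0r; case: wB => _ /(_ _ cy); rewrite ler_norml => /andP[].
move=> wB; have [mw wB'] := wB.
have mC : measurable (@circle R) by exact: measurable_circle.
apply: EFin_inj.
rewrite !EFin_Rintegral//; [|exact: bmf_integrable wB|exact: bmf_integrable (bmf_cconv nk wB)].
pose w' := w \_ (@circle R).
have mw' : measurable_fun [set: R] w' by apply/measurable_restrict => //; rewrite setTI.
have w'0 y : 0 <= w' y.
  by rewrite /w' patchE; case: ifPn => // /set_mem; exact: w0.
pose F (z : measurableTypeR R * measurableTypeR R) : \bar R :=
  (\1_(@circle R) z.1 * (r (z.1 - z.2) * w' z.2))%:E.
have mF : measurable_fun setT F.
  apply/measurable_EFinP; apply: measurable_funM; last apply: measurable_funM.
  - by apply: measurableT_comp; [exact: measurable_indic|exact: measurable_fst].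
  - apply: (measurableT_comp (nk_measurable nk)); apply: measurable_funB.
      exact: measurable_fst.
    exact: measurable_snd.
  - by apply: measurableT_comp; [exact: mw'|exact: measurable_snd].
have F0 z : (0 <= F z)%E by rewrite lee_fin !mulr_ge0 ?(nk_ge0 nk).
transitivity (\int[leb]_x \int[leb]_y F (x, y))%E.
  rewrite integral_mkcond; apply: eq_integral => x _.
  rewrite patchE; case: ifPn => cx.
    rewrite /F /= indicE cx /cconv EFin_Rintegral//; last first.
      have bk : bmf M (fun y => r (x - y)) by exact: (bmf_kernel nk (@measurable_subl _ _ x)).
      exact: bmf_integrable (bmfM bk wB).
    rewrite integral_mkcond; apply: eq_integral => y _.
    by rewrite /w' !patchE; case: ifPn => cy; rewrite ?mulr0// mul1r.
  by rewrite integral0_eq// => y _; rewrite /F/= indicE (negbTE cx) mul0r.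
rewrite (fubini_tonelli F mF F0).
rewrite [RHS]integral_mkcond; apply: eq_integral => y _.
transitivity (\int[leb]_x ((w' y)%:E * (\1_(@circle R) x * r (x - y))%:E))%E.
  by apply: eq_integral => x _; rewrite /F/= -EFinM; congr EFin; ring.
have mk : measurable_fun [set: R] (fun x => \1_(@circle R) x * r (x - y)).
  apply: measurable_funM; first exact: measurable_indic.
  by apply: (measurableT_comp (nk_measurable nk)); exact: measurable_funB.
rewrite ge0_integralZl//; last 3 first.
- exact/measurable_EFinP.
- by move=> x _; rewrite lee_fin mulr_ge0// (nk_ge0 nk).
- by rewrite lee_fin.
rewrite [X in (_ * X)%E](_ : _ = 1%E); last first.
  transitivity (\int[leb]_(x in circle) (r (x - y))%:E)%E.
    rewrite [RHS]integral_mkcond; apply: eq_integral => x _.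
    by rewrite patchE indicE; case: ifPn; rewrite ?mul1r ?mul0r.
  rewrite -EFin_Rintegral//; last first.
    apply: bmf_integrable; apply: (bmf_kernel nk); exact: measurable_funB.
  by rewrite periodic_RintegralD ?(nk_int nk)//; [exact: nk_measurable nk|exact: nk_periodic nk].
by rewrite mule1 /w' !patchE; case: ifPn.
Qed.

(* Otherwise [r z <= 1 / 2 + P (z + s) - P (z - s)] for all [z] with [s] small,
   and integrating over a period gives [1 <= 1 / 2 + 2 s V]. *)
Lemma nk_lower_bound : exists a p l, [/\ 0 < a, 0 < l <= 1 &
  forall z, p <= z <= p + l -> a <= r z].
Proof.
(* This [s] makes [2 * s * V < 1 / 2], for the contradiction, and [2 * s <= 1], for the length of
   the interval. *)
have V0 := nk_V_ge0 nk; pose s : R := (4 * V + 4)^-1.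
have s0 : 0 < s by rewrite invr_gt0; lra.
have sV : 2 * s * V < 1 / 2.
  by rewrite /s mulrAC ltr_pdivrMr; lra.
have s1 : s <= 1 / 2.
  by rewrite /s -[leRHS]mul1r mulrA mulr1 -[leRHS]mul1r -div1r ler_pdivrMr; lra.
apply: contrapT => H.
have {H} small z : r z <= 1 / 2 + (P (z + s) - P (z - s)).
  apply: contrapT => /negP; rewrite -ltNge => rz; apply: H.
  exists (1 / 2), (z - s), (2 * s); split; [lra|lra|] => t /andP[t1 t2].
  have Pt : P (z - s) <= P t /\ P t <= P (z + s) by split; apply: nk_nd nk _ _ _; lra.
  have Pz : P (z - s) <= P z /\ P z <= P (z + s) by split; apply: nk_nd nk _ _ _; lra.
  suff : `|r z - r t| <= P (z + s) - P (z - s) by rewrite ler_norml; lra.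
  have [tz|/ltW zt] := leP t z.
    by rewrite (le_trans (nk_var nk tz))//; lra.
  by rewrite distrC (le_trans (nk_var nk zt))//; lra.
suff : 1 <= 1 / 2 + 2 * s * V :> R by lra.
rewrite -{1}(kernel_int nk 0) -(variation_int nk 0 (ltW s0)).
have mP (c : R) : measurable_fun (@circle R) (fun y => P (0 - y + c)).
  apply: measurableT_comp (nk_measurable_P nk) _; apply: measurable_funD => //.
  exact: measurable_subl.
have bP c : bmf (`|P (0 + c)| + `|P (0 - 1 + c)|) (fun y => P (0 - y + c)).
  split => // y; rewrite /circle/= in_itv/= => /andP[y0 y1].
  have H1 : P (0 - y + c) <= P (0 + c) by apply: nk_nd nk _ _ _; lra.
  have H2 : P (0 - 1 + c) <= P (0 - y + c) by apply: nk_nd nk _ _ _; lra.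
  have := ler_norm (P (0 + c)); have := ler_norm (- P (0 - 1 + c)).
  have := normr_ge0 (P (0 + c)); have := normr_ge0 (P (0 - 1 + c)).
  by rewrite normrN ler_norml; lra.
rewrite -[in leRHS](Rintegral_circle_cst (1 / 2)).
rewrite -(RintegralDc (bmf_cst (1 / 2)) (bmfB (bP _) (bP _))).
apply: (le_Rintegralc (bmf_kernel nk (measurable_subl _))
  (bmfD (bmf_cst _) (bmfB (bP _) (bP _)))) => y cy; exact: small.
Qed.

End mixing.

(** * Doeblin condition and resolvent *)

Section doeblin.
Context {R : realType}.
Local Notation leb := (@lebesgue_measure R).
Variables (r : R -> R) (M : R) (P : R -> R) (V : R).
Hypothesis nk : noise_kernel r M P V.

Local Notation L := (cconv r).

(** Functions on the line rather than on [[0, 1[]: the lower bounds below integrate over intervals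
    that cross the integers. *)
Definition periodic_ge0 (f : R -> R) := [/\ measurable_fun [set: R] f,
  forall x, f (x + 1) = f x, forall x, 0 <= f x & exists B, bmf B f].

Lemma cconv_periodic_ge0 (f : R -> R) : periodic_ge0 f -> periodic_ge0 (L f).
Proof.
move=> [mf f1 f0 [B fB]]; split.
- exact: (measurable_cconv nk fB).
- exact: (cconv_periodic nk f).
- by move=> x; apply: Rintegral_ge0 => y _; rewrite mulr_ge0// (nk_ge0 nk).
- by exists B; exact: (bmf_cconv nk fB).
Qed.

Lemma iter_cconv_periodic_ge0 (n : nat) (f : R -> R) :
  periodic_ge0 f -> periodic_ge0 (iter n L f).
Proof. by move=> f0; elim: n => //= n; exact: cconv_periodic_ge0. Qed.

Lemma EFin_cconv (f : R -> R) (x t : R) : periodic_ge0 f ->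
  (L f x)%:E = (\int[leb]_(y in `[t, (t + 1)%R[) (r (x - y) * f y)%:E)%E.
Proof.
move=> [mf f1 f0 [B fB]]; have mk : measurable_fun [set: R] (fun y => r (x - y) * f y).
  apply: measurable_funM => //; apply: measurableT_comp (nk_measurable nk) _.
  exact: measurable_subl.
rewrite /cconv EFin_Rintegral; last 2 first.
- have bk : bmf M (fun y => r (x - y)) by exact: (bmf_kernel nk (@measurable_subl _ _ x)).
  exact: bmf_integrable (bmfM bk fB).
- exact: measurable_circle.
rewrite -(@periodic_integral_window _ (fun y => (r (x - y) * f y)%:E) _ _ t)//.
- exact/measurable_EFinP.
- move=> y; rewrite f1; congr (_ * _)%:E.
  by rewrite -(nk_periodic nk); congr r; ring.
Qed.

(* The lower bound of [iter n.+1 L f x] by the integral of [f] on an interval,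
   whose length grows by [l / 2] at each step: on two short arcs of [y], the
   intervals attached to [y] contain two fixed overlapping intervals. *)
Lemma iter_cconv_lower (n : nat) (a p l : R) : 0 < a -> 0 < l <= 1 ->
  (forall z, p <= z <= p + l -> a <= r z) ->
  exists c q, 0 < c /\ forall f, periodic_ge0 f -> forall x,
    (c%:E * \int[leb]_(y in `[(x - q - (l + n%:R * (l / 2)))%R, (x - q)%R]) (f y)%:E
     <= (iter n.+1 L f x)%:E)%E.
Proof.
move=> a0 /andP[l0 l1] ra; elim: n => [|n [c [q [c0 IH]]]].
  exists a, p; split => // f f0 x; have [mf f1 fge0 _] := f0.
  have mE (D : set R) : measurable_fun D (EFin \o f).
    by apply/measurable_EFinP; exact: measurable_funS mf.
  rewrite mul0r addr0 /= (EFin_cconv _ (x - p - l) f0).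
  rewrite -(@integral_itv_bndo_bndc _ _ _ (EFin \o f))//.
  have mk (D : set R) : measurable_fun D (fun y => (r (x - y) * f y)%:E).
    apply/measurable_EFinP; apply: measurable_funM.
      apply: measurableT_comp (nk_measurable nk) _; exact: measurable_subl.
    exact: measurable_funS mf.
  rewrite -ge0_integralZl//=; last 3 first.
  - exact: mE.
  - by move=> y _; rewrite lee_fin.
  - by rewrite lee_fin ltW.
  apply: (@le_trans _ _ (\int[leb]_(y in `[(x - p - l)%R, (x - p)%R[) (r (x - y) * f y)%:E)%E).
    apply: ge0_le_integral => //.
    - by move=> y _; rewrite mule_ge0// lee_fin// ltW.
    - exact: (measurable_funeM _ (mE _)).
    - exact: mk.
    - move=> y /=; rewrite in_itv/= => /andP[y1 y2].
      by rewrite lee_fin ler_wpM2r// ra//; lra.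
  apply: ge0_subset_integral => //; first exact: mk.
  - by move=> y _; rewrite lee_fin mulr_ge0// (nk_ge0 nk).
  - by move=> y /=; rewrite !in_itv/=; lra.
set m := l + n%:R * (l / 2) in IH.
have lm : l <= m by rewrite /m lerDl mulr_ge0// divr_ge0// ltW.
have -> : l + n.+1%:R * (l / 2) = m + l / 2 by rewrite /m -natr1; ring.
(* The two arcs, of length [l / 4], sit at the ends of [[x - p - l, x - p[], where the kernel is at
   least [a]. Their fixed intervals meet because [l <= m], and their union has length [m + l / 2]
   and right end [x - (p + q + l / 4)]. *)
exists (a * c * (l / 4)), (p + q + l / 4); split.
  by rewrite !mulr_gt0//; lra.
move=> f f0 x; have [mf f1 fge0 _] := f0.
have mE (D : set R) : measurable_fun D (EFin \o f).
  by apply/measurable_EFinP; exact: measurable_funS mf.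
have g0 := iter_cconv_periodic_ge0 n.+1 f0.
rewrite iterS; move: (iter n.+1 L f) g0 (IH f f0) => g g0 {}IH.
have [mg g1 gge0 _] := g0.
rewrite (EFin_cconv _ (x - p - l) g0).
have mk (D : set R) : measurable_fun D (fun y => (r (x - y) * g y)%:E).
  apply/measurable_EFinP; apply: measurable_funM.
    apply: measurableT_comp (nk_measurable nk) _; exact: measurable_subl.
  exact: measurable_funS mg.
have k0 y : (0 <= (r (x - y) * g y)%:E)%E by rewrite lee_fin mulr_ge0// (nk_ge0 nk).
pose J u v : \bar R := (\int[leb]_(y in `[u, v]) (f y)%:E)%E.
have J0 u v : (0 <= J u v)%E by apply: integral_ge0 => y _; rewrite lee_fin.
have arc u : x - p - l <= u -> u + l / 4 <= x - p ->
    ((a * c * (l / 4))%:E * J (u + l / 4 - q - m)%R (u - q)%R <=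
     \int[leb]_(y in `[u, (u + l / 4)%R[) (r (x - y) * g y)%:E)%E.
  move=> u1 u2.
  have -> : ((a * c * (l / 4))%:E * J (u + l / 4 - q - m)%R (u - q)%R =
     \int[leb]_(y in `[u, (u + l / 4)%R[) ((a * c)%:E * J (u + l / 4 - q - m)%R (u - q)%R))%E.
    rewrite integral_cst// [X in _ = (_ * X)%E]lebesgue_measure_itv/= lte_fin.
    rewrite ifT ?ltrDl ?divr_gt0// -EFinB (_ : u + l / 4 - u = l / 4)%R; last by ring.
    by rewrite [in LHS]EFinM muleAC.
  apply: ge0_le_integral => //.
  - by move=> y _; rewrite mule_ge0// lee_fin mulr_ge0// ltW.
  - exact: mk.
  - move=> y /=; rewrite in_itv/= => /andP[y1 y2].
    rewrite EFinM [leRHS]EFinM -muleA lee_pmul//.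
    + by rewrite lee_fin ltW.
    + by rewrite mule_ge0// lee_fin ltW.
    + by rewrite lee_fin ra//; lra.
    apply: le_trans (IH y); rewrite lee_pmul2l// ?lte_fin//.
    apply: ge0_subset_integral => //; first exact: mE.
    + by move=> z _; rewrite lee_fin.
    + by move=> z /=; rewrite !in_itv/=; lra.
apply: (@le_trans _ _ ((a * c * (l / 4))%:E *
    (J (x - p - l + l / 4 - q - m)%R (x - p - l - q)%R +
     J (x - p - l / 4 + l / 4 - q - m)%R (x - p - l / 4 - q)%R))%E).
  rewrite lee_pmul2l// ?lte_fin ?mulr_gt0// ?divr_gt0//.
  (* The second interval is cut where the first one ends, which gives a disjoint cover. *)
  apply: (@le_trans _ _ (\int[leb]_(y in
     `[(x - p - l + l / 4 - q - m)%R, (x - p - l - q)%R] `|`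
     `](x - p - l - q)%R, (x - p - l / 4 - q)%R]) (f y)%:E)%E).
    apply: ge0_subset_integral => //.
    - exact: measurableU.
    - exact: mE.
    - by move=> z _; rewrite lee_fin.
    - by move=> z /=; rewrite !in_itv/=; lra.
  rewrite ge0_integral_setU//; last 3 first.
  - exact: mE.
  - by move=> z _; rewrite lee_fin.
  - by apply/disj_setPS => z /=; rewrite !in_itv/=; lra.
  rewrite leeD2l//; apply: ge0_subset_integral => //; first exact: mE.
  - by move=> z _; rewrite lee_fin.
  - by move=> z /=; rewrite !in_itv/=; lra.
rewrite ge0_muleDr//.
apply: (@le_trans _ _ (\int[leb]_(y in `[(x - p - l)%R, (x - p - l + l / 4)%R[ `|`
    `[(x - p - l / 4)%R, (x - p - l / 4 + l / 4)%R[) (r (x - y) * g y)%:E)%E).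
  rewrite ge0_integral_setU//; last 2 first.
  - exact: mk.
  - by apply/disj_setPS => z /=; rewrite !in_itv/=; lra.
  by rewrite leeD// arc//; lra.
apply: ge0_subset_integral => //.
- exact: measurableU.
- exact: mk.
- by move=> z /=; rewrite !in_itv/=; lra.
Qed.

(** After enough iterations the interval of [iter_cconv_lower] contains a whole period, so the
    integral over it is at least the integral of [f] over the circle. *)
Lemma doeblin : exists N (c : R), [/\ (0 < N)%N, 0 < c & forall B f, bmf B f ->
  (forall x, circle x -> 0 <= f x) ->
  forall x, c * \int[leb]_(y in circle) f y <= iter N L f x].
Proof.
have [a [p [l [a0 l01 ra]]]] := nk_lower_bound nk.
have /andP[l0 l1] := l01.
(* Since [n > 2 / l], the length [l + n%:R * (l / 2)] is at least [1]. *)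
pose n := (Num.truncn (2 / l)).+1.
have nl : 1 <= l + n%:R * (l / 2).
  rewrite (@le_trans _ _ (2 / l * (l / 2)))//.
    by rewrite mulrA mulfVK ?divff// gt_eqF.
  rewrite ler_wpDl// ?(ltW l0)// ler_wpM2r ?divr_ge0// ?(ltW l0)//.
  by rewrite ltW// truncnS_gt.
have [c [q [c0 H]]] := iter_cconv_lower n a0 l01 ra.
exists n.+1, c; split => // B f fB f0 x; have [mf fB'] := fB.
pose f' y := f (circle_proj y).
have f'0 : periodic_ge0 f'.
  split.
  - apply: (measurable_comp (F := @circle R)).
    + exact: measurable_circle.
    + by move=> _ [z _ <-]; exact: circle_projP.
    + exact: mf.
    + exact: measurable_circle_proj.
  - by move=> y; rewrite /f' circle_projD1.
  - by move=> y; apply: f0; exact: circle_projP.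
  - exists B; split.
      apply: eq_measurable_fun mf => y /set_mem cy.
      by rewrite /f' circle_proj_id.
    by move=> y _; apply: fB'; exact: circle_projP.
have [mf' f'1 f'ge0 _] := f'0.
have mE (D : set R) : measurable_fun D (EFin \o f').
  by apply/measurable_EFinP; exact: measurable_funS mf'.
have ff' y : circle y -> f y = f' y by move=> cy; rewrite /f' circle_proj_id.
have LE : L f = L f'.
  by apply/funext => y; apply: eq_RintegralP => z cz; rewrite ff'.
have -> : iter n.+1 L f x = iter n.+1 L f' x by rewrite !iterSr LE.
rewrite -lee_fin EFinM; apply: le_trans (H _ f'0 x).
rewrite lee_pmul2l ?lte_fin// (eq_RintegralP ff') EFin_Rintegral; last 2 first.
- by case: f'0 => _ _ _ [B' /bmf_integrable].
- exact: measurable_circle.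
(* The period is taken as [[x - q - 1, x - q[], which lies inside the interval of the lower
   bound. *)
rewrite -(@periodic_integral_window _ (EFin \o f') _ _ (x - q - 1))//; last first.
  by move=> y /=; rewrite f'1.
apply: ge0_subset_integral => //; first exact: mE.
- by move=> z _; rewrite lee_fin.
- by move=> z /=; rewrite !in_itv/=; lra.
Qed.

End doeblin.

(** * Contraction on zero-average functions and the Neumann series *)

Section resolvent.
Context {R : realType}.
Local Notation leb := (@lebesgue_measure R).
Variables (r : R -> R) (M : R) (P : R -> R) (V : R).
Hypothesis nk : noise_kernel r M P V.

Local Notation L := (cconv r).
Local Notation mean w := (\int[leb]_(x in circle) w x).

Lemma bmf_iter (n : nat) (B : R) (w : R -> R) : bmf B w -> bmf B (iter n L w).
Proof. by move=> wB; elim: n => //= n; exact: (bmf_cconv nk). Qed.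

Lemma mean_iter (n : nat) (B : R) (w : R -> R) : bmf B w ->
  mean (iter n L w) = mean w.
Proof.
move=> wB; elim: n => //= n IH.
by rewrite (cconv_mean nk (bmf_iter n wB)).
Qed.

Lemma iter_cconv_affine (n : nat) (a b B : R) (w : R -> R) : bmf B w ->
  iter n L (fun y => a + b * w y) = (fun x => a + b * iter n L w x).
Proof.
move=> wB; elim: n => //= n ->; apply/funext => x.
have wn := bmf_iter n wB.
by rewrite (cconvD nk _ (bmf_cst a) (bmfM (bmf_cst b) wn)) (cconvZ nk _ _ wn) (cconv_cst nk).
Qed.

(** The Doeblin bound applied to the nonnegative functions [B + w] and [B - w], both of mean [B],
    gives [c * B <= B + iter N L w] and [c * B <= B - iter N L w], hence the rate [q = 1 - c]. *)
Lemma contraction : exists N (q : R), [/\ (0 < N)%N, 0 <= q < 1 &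
  forall B w, bmf B w -> mean w = 0 -> bmf (q * B) (iter N L w)].
Proof.
have [N [c [N0 c0 H]]] := doeblin nk.
have lower B b w x : bmf B w -> mean w = 0 -> `|b| = 1 ->
    c * B <= B + b * iter N L w x.
  move=> wB w0 b1.
  have bw : bmf (`|B| + `|b| * B) (fun y => B + b * w y).
    exact: (bmfD (bmf_cst B) (bmfM (bmf_cst b) wB)).
  have := H _ _ bw; rewrite (iter_cconv_affine _ _ _ wB) => /(_ _ x).
  rewrite (RintegralDc (bmf_cst B) (bmfM (bmf_cst b) wB)) (RintegralZc _ wB).
  rewrite w0 mulr0 addr0 Rintegral_circle_cst; apply => y cy.
  rewrite -lerBlDl sub0r; have := wB.2 _ cy.
  by rewrite -[`|w y|]mul1r -b1 -normrM ler_norml => /andP[].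
(* Tested on [w = 0] with [B = 1]; this is what makes [q] nonnegative. *)
have c1 : c <= 1.
  have b0 : bmf 1 (cst 0 : R -> R) by split => // x _; rewrite normr0.
  have := lower 1 1 (cst 0) 0 b0 (Rintegral_circle_cst _) (normr1 _).
  have -> : iter N L (cst 0) = cst 0.
    by elim: N {H lower N0} => //= n ->; apply/funext => x; rewrite (cconv_cst nk).
  by rewrite mulr1 /= mulr0 addr0.
exists N, (1 - c); split => //; first by apply/andP; split; lra.
move=> B w wB w0; split; first by have [] := bmf_iter N wB.
move=> x _; have := lower B 1 w x wB w0 (normr1 _).
have := lower B (-1) w x wB w0 (normrN1 _).
by rewrite ler_norml mul1r mulN1r; lra.
Qed.

(** Telescoping: [w - iter n L w] is the sum of the images of [w - L w] under the first [n]
    iterates, and [L] does not increase the sup norm. *)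
Lemma iter_cconv_defect (n : nat) (B E : R) (w : R -> R) : bmf B w ->
  (forall x, circle x -> `|w x - L w x| <= E) ->
  forall x, circle x -> `|w x - iter n L w x| <= n%:R * E.
Proof.
move=> wB wE; elim: n => [|n IH] x cx; first by rewrite subrr normr0 mul0r.
have wn := bmf_iter n wB.
have -> : w x - iter n.+1 L w x = (w x - L w x) + L (fun y => w y - iter n L w y) x.
  by rewrite (cconvB nk _ wB wn) /=; ring.
rewrite -natr1 mulrDl mul1r [leRHS]addrC (le_trans (ler_normD _ _))// lerD ?wE//.
apply: (cconv_bound nk); split => //.
by case: wB wn => mw _ [mwn _]; exact: measurable_funB.
Qed.

(** The function [w] is within [N%:R * E] of [iter N L w], which is at most [q * sup |w|]; solving
    for the supremum gives [K = N%:R / (1 - q)]. As [K] does not depend on [B], the bound applies to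
    partial sums whose a priori bounds grow. *)
Lemma resolvent_bound : exists2 K : R, 0 <= K & forall (B E : R) w, bmf B w ->
  mean w = 0 -> (forall x, circle x -> `|w x - L w x| <= E) -> bmf (K * E) w.
Proof.
have [N [q [N0 /andP[q0 q1] H]]] := contraction.
exists (N%:R / (1 - q)); first by rewrite divr_ge0// subr_ge0 ltW.
move=> B E w wB w0 wE.
(* The a priori bound [B] only ensures that this supremum is finite. *)
pose A := [set `|w x| | x in circle].
have c0 : circle (0 : R) by rewrite /circle/= in_itv/= lexx ltr01.
have A0 : A !=set0 by exists `|w 0|, 0.
have supA : has_sup A.
  by split => //; exists B => _ [x cx <-]; exact: wB.2.
have wS : bmf (sup A) w.
  by split=> [|x cx]; [case: wB|apply: ub_le_sup; [case: supA|exists x]].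
have SE : sup A <= N%:R * E + q * sup A.
  apply: ge_sup => // _ [x cx <-].
  have := iter_cconv_defect N wB wE cx; have := (H _ _ wS w0).2 _ cx.
  move: (iter N L w x) => z zq wz.
  by rewrite -(subrK z (w x)); apply: le_trans (ler_normD _ _) _; exact: lerD.
apply: bmfW wS; rewrite mulrAC ler_pdivlMr; last by rewrite subr_gt0.
by rewrite mulrBr mulr1; lra.
Qed.


(** Each block of [N] iterations contracts by [q], and the remaining [n %% N] ones do not increase
    the norm. *)
Lemma iter_decay (B : R) (v : R -> R) : bmf B v -> mean v = 0 ->
  exists2 b : nat -> R, b @ \oo --> 0 & forall n, bmf (b n) (iter n L v).
Proof.
move=> vB v0; have [N [q [N0 /andP[q0 q1] H]]] := contraction.
have Hk k : bmf (q ^+ k * B) (iter (k * N) L v).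
  elim: k => [|k IH]; first by rewrite expr0 mul1r.
  rewrite mulSn iterD exprS -mulrA; apply: H => //.
  by rewrite (mean_iter _ vB).
exists (fun n => q ^+ (n %/ N) * B) => [|n]; last first.
  by rewrite {2}(divn_eq n N) addnC iterD; exact: bmf_iter.
rewrite -(mul0r B); apply: cvgMl.
apply: (@cvg_comp _ _ _ (fun n => n %/ N)%N (fun k => q ^+ k) _ \oo).
  move=> A [k _ kA]; exists (k * N)%N => // n /= kn; apply: kA => /=.
  by rewrite leq_divRL.
have := @cvg_geometric R 1 q; rewrite ger0_norm// => /(_ q1).
by rewrite (_ : geometric 1 q = (fun k => q ^+ k))//; apply/funext => k; rewrite /geometric/= mul1r.
Qed.

(** The partial sums [s n] are Cauchy without summing any geometric series: [id - L] maps
    [s m - s n] to [iter n L v - iter m L v], so [resolvent_bound] controls their distance by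
    [K * (b n + b m)]. *)
Lemma resolvent_exists (B : R) (v : R -> R) : bmf B v -> mean v = 0 ->
  exists (h : R -> R) (B' : R) (e : nat -> R), [/\ bmf B' h, mean h = 0,
    forall x, circle x -> h x - L h x = v x, e @ \oo --> 0 &
    forall n x, circle x -> `|\sum_(0 <= k < n) iter k L v x - h x| <= e n].
Proof.
move=> vB v0; have [b b0 vb] := iter_decay vB v0.
have [K K0 HK] := resolvent_bound.
pose s n (x : R) := \sum_(0 <= k < n) iter k L v x.
have s_S n : s n.+1 = (fun x => s n x + iter n L v x).
  by apply/funext => x; rewrite /s big_nat_recr.
have bs n : bmf (n%:R * B) (s n).
  elim: n => [|n IH].
    have -> : s 0%N = cst 0 by apply/funext => x; rewrite /s big_nil.
    by split => // x _; rewrite normr0 mul0r.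
  by rewrite s_S -natr1 mulrDl mul1r; exact: (bmfD IH (bmf_iter n vB)).
have s0 n : mean (s n) = 0.
  elim: n => [|n IH].
    by rewrite -[RHS](Rintegral_circle_cst 0); apply: eq_RintegralP => x _; rewrite /s big_nil.
  by rewrite s_S (RintegralDc (bs n) (bmf_iter n vB)) IH (mean_iter n vB) v0 addr0.
have sL n x : s n x - L (s n) x = v x - iter n L v x.
  elim: n => [|n IH].
    rewrite /= /s big_nil subrr; have -> : (fun x0 => \sum_(0 <= k < 0) iter k L v x0) = cst 0.
      by apply/funext => y; rewrite big_nil.
    by rewrite (cconv_cst nk) subrr.
  rewrite s_S (cconvD nk _ (bs n) (bmf_iter n vB)) /=.
  by rewrite opprD addrACA IH; ring.
have dist m n x : circle x -> `|s m x - s n x| <= K * (b n + b m).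
  move=> cx.
  have bd := bmfB (bs m) (bs n).
  refine ((HK _ (b n + b m) _ bd _ _).2 x cx).
    by rewrite (RintegralBc (bs m) (bs n)) !s0 subrr.
  move=> y cy; rewrite (cconvB nk _ (bs m) (bs n)).
  have -> : s m y - s n y - (L (s m) y - L (s n) y) = iter n L v y - iter m L v y.
    have := sL m y; have := sL n y.
    move: (s m y) (s n y) (L (s m) y) (L (s n) y) (iter n L v y) (iter m L v y) => *; lra.
  by rewrite (le_trans (ler_normB _ _))// lerD// ?(vb _).2.
have cs x : circle x -> cvg (s ^~ x @ \oo).
  move=> cx; apply/cauchy_cvgP/cauchy_exP => e e0.
  have e2 : 0 < e / 2 by rewrite divr_gt0.
  have b2 : \forall n \near \oo, K * b n < e / 2.
    have bK : (fun n => K * b n) @ \oo --> K * 0 by exact: cvgMr.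
    by move: bK; rewrite mulr0 => /cvgr_lt; exact.
  have [n _ nb] := b2.
  exists (s n x); exists n => // m nm; rewrite /ball/= distrC.
  rewrite (le_lt_trans (dist m n x cx))// mulrDr [ltRHS]splitr ltrD ?nb//=.
pose h x := lim (s ^~ x @ \oo).
have hs n x : circle x -> `|s n x - h x| <= K * b n.
  move=> cx; have cK : (fun m => K * (b m + b n)) @ \oo --> K * (0 + b n).
    by apply: cvgMr; apply: cvgD => //; exact: cvg_cst.
  rewrite -[b n in leRHS]add0r; apply: (ler_cvg_to _ cK); last first.
    by near=> m; exact: dist n m x cx.
  by apply: cvg_norm; apply: cvgB; [exact: cvg_cst|exact: cs].
have bh : bmf (K * b 0%N) h.
  split.
    by apply: (@measurable_fun_cvg _ _ _ _ s); [move=> m; case: (bs m)|exact: cs].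
  by move=> x cx; have := hs 0%N _ cx; rewrite /s big_nil sub0r normrN.
have bhs n : bmf (K * b n) (fun x => s n x - h x).
  by split; [case: (bs n) bh => ? _ [? _]; exact: measurable_funB|exact: hs].
(* The mean of [h] and the equation [h - L h = v] are both obtained by comparison with [s n], with
   an error that vanishes with [b n]. *)
have small (z : R) (C : R) : (forall n, `|z| <= C * b n) -> z = 0.
  move=> zb; apply/eqP; rewrite -normr_le0 -(mulr0 C).
  have cb : (fun n => C * b n) @ \oo --> C * 0 by exact: cvgMr.
  apply: (ler_cvg_to (@cvg_cst _ `|z| _ \oo _) cb).
  by near=> n; exact: zb.
exists h, (K * b 0%N), (fun n => K * b n); split => //.
- apply: (small _ K) => n; rewrite -normrN.
  have := bmf_Rintegral_le (bhs n).
  by rewrite (RintegralBc (bs n) bh) s0 sub0r.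
- move=> x cx; apply/eqP; rewrite -subr_eq0; apply/eqP.
  (* One [K] for [s n - h], one for its image by [L], and [1] for the remainder [iter n L v]. *)
  apply: (small _ (K + K + 1)) => n.
  have H1 := (bhs n).2 _ cx.
  have H2 := cconv_bound nk x (bhs n); rewrite (cconvB nk _ (bs n) bh) in H2.
  have H3 := (vb n).2 _ cx.
  have H4 := sL n x.
  move: H1 H2 H3 H4; rewrite !ler_norml.
  move: (s n x) (h x) (L (s n) x) (L h x) (iter n L v x) (v x) => *; lra.
- by rewrite -(mulr0 K); exact: cvgMr.
Unshelve. all: by end_near. Qed.

End resolvent.

(** * The kernel of a density of bounded variation *)

Section noise.
Context {R : realType}.
Local Notation leb := (@lebesgue_measure R).

Lemma measurable_comp_proj (w : R -> R) : measurable_fun (@circle R) w ->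
  measurable_fun [set: R] (w \o circle_proj).
Proof.
move=> mw; apply: (measurable_comp (F := @circle R)) => //.
- exact: measurable_circle.
- by move=> _ [z _ <-]; exact: circle_projP.
- exact: measurable_circle_proj.
Qed.

Lemma noise_kernel_shift (r P : R -> R) (M V theta : R) :
  noise_kernel r M P V ->
  noise_kernel (fun x => r (x - theta)) M (fun x => P (x - theta)) V.
Proof.
move=> nk; split.
- apply: measurableT_comp (nk_measurable nk) _; exact: measurable_funB.
- by move=> x; rewrite addrAC (nk_periodic nk).
- by move=> x; exact: nk_ge0 nk _.
- by move=> x; exact: nk_le nk _.
- by rewrite periodic_RintegralD ?(nk_int nk)//; [exact: nk_measurable nk|exact: nk_periodic nk].
- by move=> a b ab; apply: (nk_var nk); rewrite lerB.
- by move=> x; rewrite addrAC (nk_varD1 nk).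
Qed.

(** The variation function [T] on [[0, 1]] is continued with an increment [V] per period. The term
    [|rho 1 - rho 0|] in [V] pays for the jump of the periodic extension at the integers, where [0]
    and [1] are glued. *)
Lemma noise_kernel_bv (rho : R -> R) : probability_density rho ->
  bounded_variation 0 1 rho ->
  exists M P V, noise_kernel (rho \o circle_proj) M P V.
Proof.
move=> [mrho rho0 rho1] bv.
pose T x := fine (total_variation 0 x rho).
have varT a b : 0 <= a -> a <= b -> b <= 1 -> `|rho b - rho a| <= T b - T a.
  move=> a0 ab b1; have b0 := le_trans a0 ab.
  have bvb := bounded_variationl b0 b1 bv.
  have bva := bounded_variationl a0 ab bvb.
  have bvab := bounded_variationr a0 ab bvb.
  have fb := (bounded_variationP _ b0).1 bvb.
  have fa := (bounded_variationP _ a0).1 bva.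
  have fab := (bounded_variationP _ ab).1 bvab.
  rewrite {1}/T (total_variationD rho a0 ab) fineD// [_ + fine _]addrC addrK.
  by rewrite -lee_fin fineK//; exact: total_variation_ge.
have T0 : T 0 = 0 by rewrite /T total_variationxx.
pose V := T 1 + `|rho 1 - rho 0|.
exists (`|rho 0| + T 1), (fun x => (Num.floor x)%:~R * V + T (circle_proj x)), V.
have proj01 (x : R) : 0 <= circle_proj x < 1.
  by have := circle_projP x; rewrite /circle/= in_itv.
split.
- exact: measurable_comp_proj.
- by move=> x /=; rewrite circle_projD1.
- by move=> x; apply: rho0; exact: circle_projP.
- move=> x /=; have /andP[x0 x1] := proj01 x.
  have := varT _ _ (lexx 0) x0 (ltW x1); have := varT _ _ x0 (ltW x1) (lexx 1).
  have := ler_norm (rho 0); have := normr_ge0 (rho 1 - rho (circle_proj x)).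
  by rewrite (ler_norml (_ - rho 0)) T0; lra.
- rewrite (@eq_RintegralP _ _ _ rho); last first.
    by move=> x cx /=; rewrite circle_proj_id.
  by rewrite /Rintegral rho1.
- move=> a b ab /=.
  have /andP[a0 a1] := proj01 a; have /andP[b0 b1] := proj01 b.
  have [fab|fab] := eqVneq (Num.floor a) (Num.floor b).
    rewrite fab opprD addrACA subrr add0r.
    apply: varT => //; last exact: ltW.
    by rewrite /circle_proj fab lerB.
  have fab1 : (Num.floor a)%:~R + 1 <= (Num.floor b)%:~R :> R.
    rewrite -[1]/(1%:~R) -intrD ler_int lezD1 lt_neqAle fab.
    exact: Num.Theory.le_floor.
  have Va := varT _ _ a0 (ltW a1) (lexx 1).
  have Vb := varT _ _ (lexx 0) b0 (ltW b1).
  have T1 : 0 <= T 1.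
    by have := varT _ _ (lexx 0) ler01 (lexx 1); rewrite T0 subr0; exact: le_trans.
  have V0 : 0 <= V by rewrite addr_ge0.
  have : V <= ((Num.floor b)%:~R - (Num.floor a)%:~R) * V.
    by rewrite ler_peMl//; lra.
  rewrite mulrBl => VV.
  (* When an integer separates [a] and [b], the increment is cut into the part before [1], the jump
     and the part after [0]; at least one full [V] is available to absorb them. *)
  have -> : rho (circle_proj b) - rho (circle_proj a) =
    (rho (circle_proj b) - rho 0) - (rho 1 - rho 0) + (rho 1 - rho (circle_proj a)).
    by ring.
  apply: le_trans (ler_normD _ _) _; apply: le_trans (lerD (ler_normB _ _) (lexx _)) _.
  have VE : V = T 1 + `|rho 1 - rho 0| by []; lra.
- move=> x; rewrite circle_projD1 Num.Theory.floorDrz ?intr_int//.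
  by rewrite Num.Theory.floor1 intrD; ring.
Qed.

End noise.

(** * Stationary densities *)

Section densities.
Context {R : realType}.
Local Notation leb := (@lebesgue_measure R).
Local Notation mT := (measurableTypeR R).
Implicit Types (mu : {measure set mT -> \bar R}).

Lemma integral_restr_circle (A : set R) (f : R -> \bar R) :
  (\int[leb]_(x in circle `&` A) f x = \int[leb]_(x in A) (f \_ circle) x)%E.
Proof. by rewrite integral_mkcondl. Qed.

Lemma bmf_restrict (B : R) (g : R -> R) : bmf B g ->
  leb.-integrable [set: R] (EFin \o (g \_ (@circle R))).
Proof.
move=> /bmf_integrable; rewrite /L1 integrable_mkcond; last exact: measurable_circle.
by rewrite restrict_EFin.
Qed.

(** The function [g] is identified almost everywhere with the Radon-Nikodym derivative, for which
    the change of variables is known. *)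
Lemma integral_density mu (B : R) (g : R -> R) : (mu [set: mT] < +oo)%E ->
  bmf B g -> (forall x, 0 <= g x) ->
  (forall A : set mT, measurable A ->
    mu A = \int[leb]_(x in circle `&` A) (g x)%:E)%E ->
  forall f : R -> R, measurable_fun [set: R] f -> (forall x, 0 <= f x) ->
  (\int[mu]_x (f x)%:E = \int[leb]_(x in circle) (f x * g x)%:E)%E.
Proof.
move=> muoo gB g0 muE f mf f0.
have mC : measurable (@circle R) by exact: measurable_circle.
(* Restricting [mu] to the whole line only bundles it as a finite measure. *)
pose nu : {finite_measure set mT -> \bar R} := mfrestr measurableT muoo.
have nuE A : nu A = mu A by rewrite /nu /= /mfrestr /mrestr setIT.
have dom : nu `<< leb.
  apply/null_content_dominatesP => A mA A0; apply: etrans (nuE A) _; rewrite muE//.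
  apply: null_set_integral.
  - exact: measurableI.
  - by apply/measurable_EFinP; apply: measurable_funS (gB.1) => //; exact: subIsetl.
  - by apply: (subset_measure0 _ mA _ A0) => //; exact: measurableI.
pose d := Radon_Nikodym_SigmaFinite.f nu leb.
have mf' : measurable_fun [set: mT] (EFin \o f) by exact/measurable_EFinP.
have f0' x : (0 <= (EFin \o f) x)%E by rewrite lee_fin.
rewrite (_ : (\int[mu]_x (f x)%:E)%E = (\int[nu]_x (EFin \o f) x)%E); last first.
  by apply: eq_measure_integral => A mA _; exact/esym/nuE.
rewrite -(Radon_Nikodym_SigmaFinite.change_of_variables dom f0' measurableT mf').
have ig := bmf_restrict gB.
have id := Radon_Nikodym_SigmaFinite.f_integrable dom.
have ae : ae_eq leb [set: mT] d (EFin \o (g \_ (@circle R))).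
  apply: integral_ae_eq => //; first exact: measurable_int ig.
  move=> E _ mE; rewrite -Radon_Nikodym_SigmaFinite.f_integral//.
  apply: etrans (nuE E) _; rewrite muE//.
  by rewrite integral_restr_circle restrict_EFin.
rewrite [RHS]integral_mkcond.
transitivity (\int[leb]_x ((f x)%:E * (EFin \o (g \_ (@circle R))) x))%E.
  apply: ae_eq_integral => //.
  - by apply: emeasurable_funM => //; exact: measurable_int id.
  - by apply: emeasurable_funM => //; exact: measurable_int ig.
  - by apply: filterS ae => x dx _; congr (_ * _)%E; exact: dx.
apply: eq_integral => x _ /=; rewrite !patchE; case: ifPn => _ //=.
by rewrite mule0.
Qed.

Lemma is_density_unique (nu : set mT -> \bar R) (g h : R -> R) :
  is_density nu g -> is_density nu h -> ae_eq leb circle (EFin \o g) (EFin \o h).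
Proof.
move=> [ig gE] [ih hE]; apply: integral_ae_eq => //.
- exact: measurable_circle.
- exact: measurable_int ih.
- by move=> E EC mE; rewrite -gE// -hE.
Qed.

Lemma density_ae (nu : set mT -> \bar R) (g : R -> R) : is_density nu g ->
  is_density nu (density nu) /\ ae_eq leb circle (EFin \o density nu) (EFin \o g).
Proof.
move=> dg; have dd : is_density nu (density nu).
  by rewrite /density; apply: (xgetPex (cst 0)); exists g.
by split => //; exact: is_density_unique dd dg.
Qed.

(** The noise makes any stationary measure absolutely continuous. Taking for [g] the integral of
    [r (x - T y)] against [mu], rather than an arbitrary version of the density, makes the fixed
    point equation, the bound [M] and the periodicity hold at every point. *)
Lemma stationary_density (rho T P : R -> R) (M V : R) mu :
  noise_kernel (rho \o circle_proj) M P V ->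
  measurable_fun [set: R] T -> (forall x, circle (T x)) ->
  circle_probability mu -> stationary T rho mu ->
  exists g : R -> R, [/\ bmf M g /\ measurable_fun [set: R] g,
    (forall x, g (x + 1) = g x) /\ (forall x, 0 <= g x),
    (forall A : set mT, measurable A ->
      mu A = \int[leb]_(x in circle `&` A) (g x)%:E)%E,
    \int[leb]_(x in circle) g x = 1 &
    forall x, g x = \int[leb]_(y in circle) ((rho \o circle_proj) (x - T y) * g y)].
Proof.
move=> nk mTT TC [muT muC] st; set r := rho \o circle_proj in nk *.
have mC : measurable (@circle R) by exact: measurable_circle.
have M0 := nk_M_ge0 nk.
have muoo : (mu [set: mT] < +oo)%E by rewrite muT ltry.
pose nu : {finite_measure set mT -> \bar R} := mfrestr measurableT muoo.
have nuE A : nu A = mu A by rewrite /nu /= /mfrestr /mrestr setIT.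
pose g x := fine (\int[mu]_y (r (x - T y))%:E)%E.
have mrT x : measurable_fun [set: mT] (fun y => r (x - T y)).
  by apply: (measurableT_comp (nk_measurable nk)); exact: measurable_funB.
have intM x : (0 <= \int[mu]_y (r (x - T y))%:E <= M%:E)%E.
  apply/andP; split.
    by apply: integral_ge0 => y _; rewrite lee_fin (nk_ge0 nk).
  rewrite (@le_trans _ _ (\int[mu]_(y in [set: mT]) (cst M%:E) y)%E)//.
    apply: ge0_le_integral => //.
    - by move=> y _; rewrite lee_fin (nk_ge0 nk).
    - exact/measurable_EFinP.
    - by move=> y _; rewrite lee_fin (nk_le nk).
  by rewrite integral_cst// muT mule1.
have gE x : (g x)%:E = (\int[mu]_y (r (x - T y))%:E)%E.
  by rewrite fineK// (@fin_numElt R); have /andP[i0 iM] := intM x;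
     rewrite (lt_le_trans _ i0)//= (le_lt_trans iM) ?ltry.
have g0 x : 0 <= g x by rewrite -lee_fin gE; case/andP: (intM x).
have gM x : g x <= M by rewrite -lee_fin gE; case/andP: (intM x).
have cE : conv_measure rho (pushforward mu (T : mT -> mT)) = g.
  apply/funext => x; rewrite /conv_measure /g; congr fine.
  have mr : measurable_fun [set: mT] (fun y => (r (x - y))%:E).
    apply/measurable_EFinP; apply: (measurableT_comp (nk_measurable nk)).
    exact: measurable_funB.
  have := @ge0_integral_pushforward _ _ mT mT R T mTT mu circle (fun y => (r (x - y))%:E) mC.
  move=> /(_ (measurable_funS measurableT (@subsetT _ _) mr)).
  have -> : T @^-1` circle = [set: R].
    by apply/seteqP; split => // y _; exact: TC.
  by move=> -> // y _; rewrite lee_fin; exact: nk_ge0 nk _.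
have mg : measurable_fun [set: R] g.
  apply/measurable_EFinP.
  (* As a partial integral of a jointly measurable function, [g] is measurable. *)
  pose F (z : mT * mT) : \bar R := (r (z.1 - T z.2))%:E.
  have mF : measurable_fun setT F.
    apply/measurable_EFinP; apply: (measurableT_comp (nk_measurable nk)).
    apply: measurable_funB; first exact: measurable_fst.
    by apply: (measurableT_comp mTT); exact: measurable_snd.
  have F0 z : (0 <= F z)%E by rewrite lee_fin (nk_ge0 nk).
  have := @measurable_fun_fubini_tonelli_F _ _ mT mT R nu F mF F0.
  apply: eq_measurable_fun => x _ /=; rewrite gE /fubini_F.
  by apply: eq_measure_integral => A mA _; exact: nuE.
have gB : bmf M g.
  by split=> [|x _]; [exact: measurable_funTS|rewrite ger0_norm].
have muE A : measurable A -> mu A = (\int[leb]_(x in circle `&` A) (g x)%:E)%E.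
  by move=> mA; rewrite st// cE.
exists g; split => //.
- split => // x; rewrite /g; congr fine; apply: eq_integral => y _.
  by rewrite addrAC (nk_periodic nk).
- by rewrite /Rintegral -[circle]setIT -muE// muT.
- move=> x; by rewrite {1}/g (integral_density muoo gB g0 muE (mrT x))// => y; exact: nk_ge0 nk _.
Qed.

End densities.

(** * The operator of the unperturbed rotation *)

Section rotation.
Context {R : realType}.
Local Notation leb := (@lebesgue_measure R).
Local Notation mT := (measurableTypeR R).
Variables (theta : R) (rho : R -> R) (M : R) (P : R -> R) (V : R).
Let r := rho \o circle_proj.
Hypothesis nk : noise_kernel r M P V.
Let rt (x : R) := r (x - theta).

Lemma measurable_rotation : measurable_fun [set: R] (rotation theta).
Proof.
by apply: (measurableT_comp measurable_circle_proj); exact: measurable_funD.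
Qed.

Lemma rotation_circle (x : R) : circle (rotation theta x).
Proof. exact: circle_projP. Qed.

Lemma periodic_subz (T : Type) (F : R -> T) : (forall x, F (x + 1) = F x) ->
  forall x y, F (x - circle_proj y) = F (x - y).
Proof.
move=> F1 x y; rewrite /circle_proj opprB addrCA.
by rewrite addrC (periodicDz F1).
Qed.

Lemma kernel_rotation (x y : R) : r (x - rotation theta y) = rt (x - y).
Proof.
rewrite /rotation (periodic_subz (nk_periodic nk)) /rt.
by congr r; ring.
Qed.

Lemma circle_leb_probability : circle_probability (@circle_leb R).
Proof.
split; first by rewrite /circle_leb /= /mrestr setTI; exact: lebesgue_circle.
by rewrite /circle_leb /= /mrestr setICl measure0.
Qed.

Lemma circle_lebE (A : set mT) : measurable A ->
  circle_leb A = (\int[leb]_(x in circle `&` A) 1)%E.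
Proof.
move=> mA; rewrite integral_cst ?mul1e ?[RHS]mul1e; last first.
  by apply: measurableI => //; exact: measurable_circle.
by rewrite /circle_leb /= /mrestr setIC.
Qed.

Lemma circle_leb_stationary : stationary (rotation theta) rho circle_leb.
Proof.
move=> A mA; rewrite circle_lebE//; apply: eq_integral => x _; congr EFin.
rewrite /conv_measure.
have mr : measurable_fun [set: mT] (fun y => (r (x - y))%:E).
  apply/measurable_EFinP; apply: (measurableT_comp (nk_measurable nk)).
  exact: measurable_funB.
have mC : measurable (@circle R) by exact: measurable_circle.
have := @ge0_integral_pushforward _ _ mT mT R (rotation theta) measurable_rotation
  circle_leb circle (fun y => (r (x - y))%:E) mC.
move=> /(_ (measurable_funS measurableT (@subsetT _ _) mr)).
have -> : rotation theta @^-1` circle = [set: R].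
  by apply/seteqP; split => // y _; exact: rotation_circle.
move=> -> ; last by move=> y _; rewrite lee_fin; exact: nk_ge0 nk _.
have [lT _] := circle_leb_probability.
have muoo : (circle_leb [set: mT] < +oo)%E by rewrite lT ltry.
have b1 : bmf `|1| (cst 1 : R -> R) by exact: bmf_cst.
rewrite (@integral_density _ circle_leb _ _ muoo b1 _ _ (fun y : R => r (x - rotation theta y)))//.
- apply: etrans (esym (kernel_int (noise_kernel_shift theta nk) x)) _.
  by apply: eq_RintegralP => y _; rewrite kernel_rotation mulr1.
- exact: circle_lebE.
- apply: (measurableT_comp (nk_measurable nk)); apply: measurable_funB => //.
  exact: measurable_rotation.
- by move=> y; exact: nk_ge0 nk _.
Qed.

(** The zero-average function [g - 1] is fixed by [L], so [resolvent_bound] with [E = 0] annihilates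
    it. *)
Lemma rotation_stationary_unique (mu : {measure set mT -> \bar R}) :
  circle_probability mu -> stationary (rotation theta) rho mu ->
  forall A, measurable A -> mu A = circle_leb A.
Proof.
move=> muP st A mA.
have [g [[gB mg] _ muE g1 gE]] :=
  stationary_density nk measurable_rotation rotation_circle muP st.
have nkt := noise_kernel_shift theta nk.
have [K K0 HK] := resolvent_bound nkt.
have gL x : g x = cconv rt g x.
  by rewrite gE; apply: eq_RintegralP => y _; rewrite -/r kernel_rotation.
have b1 : bmf `|1| (cst 1 : R -> R) by exact: bmf_cst.
have wB : bmf (K * 0) (fun x => g x - 1).
  apply: (HK (M + `|1|)); first exact: bmfB gB b1.
    by rewrite (RintegralBc gB b1) g1 Rintegral_circle_cst subrr.
  move=> x _; rewrite (cconvB nkt _ gB b1) (cconv_cst nkt) -gL.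
  by rewrite subrr normr0.
rewrite muE// circle_lebE//; apply: eq_integral => x /set_mem[cx _].
have := wB.2 _ cx; rewrite mulr0 normr_le0 subr_eq0 => /eqP ->//.
Qed.

Lemma transfer_rotation (B : R) (w : R -> R) : bmf B w ->
  is_density (pushforward
    (fun A : set mT => (\int[leb]_(x in circle `&` A) (w x)%:E)%E)
    (rotation theta : mT -> mT)) (fun y => w (circle_proj (y - theta))).
Proof.
move=> wB; have [mw wB'] := wB.
have mwt : measurable_fun [set: R] (fun y => w (circle_proj (y - theta))).
  apply: (measurableT_comp (measurable_comp_proj mw)); exact: measurable_funB.
split.
  apply: (@bmf_integrable _ B); split; first exact: measurable_funTS.
  by move=> y _; apply: wB'; exact: circle_projP.
move=> A mA AC; rewrite /pushforward.
(* Written with an indicator and [circle_proj], the integrand is periodic and can be translated by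
   [- theta]. *)
pose F (y : R) : \bar R := (w (circle_proj y) * \1_A (rotation theta y))%:E.
transitivity (\int[leb]_(y in circle) F y)%E.
  rewrite integral_mkcondr; apply: eq_integral => y /set_mem cy.
  rewrite /F patchE indicE circle_proj_id//.
  have -> : (y \in rotation theta @^-1` A) = (rotation theta y \in A) by [].
  by case: (rotation theta y \in A); rewrite ?mulr1 ?mulr0.
have mF : measurable_fun [set: R] F.
  apply/measurable_EFinP; apply: measurable_funM; first exact: measurable_comp_proj.
  by apply: measurableT_comp; [exact: measurable_indic|exact: measurable_rotation].
have F1 y : F (y + 1) = F y.
  by rewrite /F /rotation addrAC !circle_projD1.
rewrite -(periodic_integralD mF F1 (- theta)).
have -> : (\int[leb]_(x in A) (w (circle_proj (x - theta)))%:E =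
    \int[leb]_(x in circle `&` A) (w (circle_proj (x - theta)))%:E)%E.
  by rewrite setIidr.
rewrite integral_mkcondr; apply: eq_integral => y /set_mem cy.
rewrite /F patchE indicE /rotation subrK (circle_proj_id cy).
by case: (y \in A); rewrite ?mulr1 ?mulr0.
Qed.

(** The density chosen by [transfer] is known only almost everywhere, but the convolution erases
    this ambiguity, hence an equality of functions, which can be iterated. *)
Lemma noisy_transfer_rotation (B : R) (w : R -> R) : bmf B w ->
  noisy_transfer (rotation theta) rho w = cconv rt w.
Proof.
move=> wB; have [mw wB'] := wB.
have [[iD _] ae] := density_ae (transfer_rotation wB).
apply/funext => x; rewrite /noisy_transfer /conv /cconv.
transitivity (\int[leb]_(y in circle) (r (x - y) * w (circle_proj (y - theta)))).
  congr fine; apply: ae_eq_integral.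
  - exact: measurable_circle.
  - apply/measurable_EFinP; apply: measurable_funM.
      apply: (measurableT_comp (nk_measurable nk)); exact: measurable_funB.
    by apply/measurable_EFinP; exact: measurable_int iD.
  - apply/measurable_EFinP; apply: measurable_funM.
      apply: (measurableT_comp (nk_measurable nk)); exact: measurable_funB.
    apply: measurable_funTS.
    apply: (measurableT_comp (measurable_comp_proj mw)); exact: measurable_funB.
  - apply: filterS ae => y dy cy; congr EFin; congr (_ * _).
    exact: (EFin_inj (dy cy)).
pose G y := rt (x - y) * w (circle_proj y).
have mG : measurable_fun [set: R] G.
  apply: measurable_funM; last exact: measurable_comp_proj.
  apply: (measurableT_comp (nk_measurable (noise_kernel_shift theta nk))).
  exact: measurable_funB.
have G1 y : G (y + 1) = G y.
  rewrite /G circle_projD1; congr (_ * _).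
  by rewrite /rt -[LHS](nk_periodic nk); congr r; ring.
transitivity (\int[leb]_(y in circle) G (y - theta)).
  by apply: eq_RintegralP => y _; rewrite /G /rt; congr (r _ * _); ring.
rewrite periodic_RintegralD//.
by apply: eq_RintegralP => y cy; rewrite /G circle_proj_id.
Qed.

End rotation.

(** * Lipschitz functions and change of variables *)

Section stieltjes.
Context {R : realType}.
Local Notation leb := (@lebesgue_measure R).
Local Notation mT := (measurableTypeR R).

Lemma lebesgue_stieltjes_itv (F : cumulative R R) (a b : R) : a <= b ->
  lebesgue_stieltjes_measure F `]a, b]%classic = (F b - F a)%:E.
Proof.
move=> ab; rewrite /lebesgue_stieltjes_measure /measure_extension.
rewrite measurable_mu_extE/=; last exact: is_ocitv.
by rewrite wlength_itv_bnd.
Qed.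

(* The Stieltjes measures of [F] and [G] add up to twice the Lebesgue measure. *)
Lemma stieltjes_dominates (F G : cumulative R R) :
  (forall x, F x + G x = 2 * x) -> lebesgue_stieltjes_measure F `<< leb.
Proof.
move=> FG.
have h2 : 0 <= 1 / 2 :> R by lra.
pose mu : {measure set mT -> \bar R} := mscale (NngNum h2)
  (measure_add (lebesgue_stieltjes_measure F) (lebesgue_stieltjes_measure G)).
have muE A : mu A = ((1 / 2)%:E * (lebesgue_stieltjes_measure F A +
    lebesgue_stieltjes_measure G A))%E.
  by rewrite -measure_addE.
have lmu A : measurable A -> leb A = mu A.
  apply: lebesgue_measure_unique => _ [[a b]] _ <-; rewrite muE /=.
  have [ab|ba] := leP a b; last first.
    by rewrite set_itv_ge ?bnd_simp -?leNgt ?(ltW ba)// !measure0 adde0 mule0.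
  rewrite !lebesgue_stieltjes_itv// lebesgue_measure_itv/= lte_fin.
  rewrite -EFinD -EFinM; have -> : 1 / 2 * (F b - F a + (G b - G a)) = b - a.
    by have := FG a; have := FG b; lra.
  case: ifPn => // ; rewrite -leNgt => ba.
  by rewrite (_ : b = a) ?subrr//; apply/eqP; rewrite eq_le ab ba.
apply/null_content_dominatesP => A mA A0.
have : mu A = 0%E by rewrite -lmu.
rewrite muE => /eqP; rewrite mule_eq0 => /orP[/eqP[h]|]; first by exfalso; lra.
by rewrite padde_eq0// => /andP[/eqP].
Qed.


(** Composing with [clamp] extends a map of [[0, 1]] by constants, since Stieltjes measures require
    a monotone function on the whole line. *)
Definition clamp (x : R) : R := Num.max 0 (Num.min x 1).

Lemma clamp01 (x : R) : 0 <= clamp x <= 1.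
Proof. by rewrite /clamp le_max lexx/= ge_max ler01/= ge_min lexx orbT. Qed.

Lemma clamp_id (x : R) : 0 <= x <= 1 -> clamp x = x.
Proof. by move=> /andP[x0 x1]; rewrite /clamp (min_idPl x1) (max_idPr x0). Qed.

Lemma clamp_le0 (x : R) : x <= 0 -> clamp x = 0.
Proof.
move=> x0; rewrite /clamp (min_idPl _) ?(max_idPl _)//.
exact: le_trans x0 ler01.
Qed.

Lemma clamp_ge1 (x : R) : 1 <= x -> clamp x = 1.
Proof. by move=> x1; rewrite /clamp (min_idPr x1) (max_idPr ler01). Qed.

Lemma clamp_lip (x y : R) : x <= y -> 0 <= clamp y - clamp x <= y - x.
Proof.
move=> xy; have [x0|x0] := leP x 0; have [x1|x1] := leP 1 x;
  have [y0|y0] := leP y 0; have [y1|y1] := leP 1 y;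
  rewrite ?(clamp_le0 x0) ?(clamp_ge1 x1) ?(clamp_le0 y0) ?(clamp_ge1 y1)
    ?(@clamp_id x) ?(@clamp_id y); lra.
Qed.

Definition graph_clamp (S : R -> R) (x : R) : R := clamp x + S (clamp x).

Definition lip01 (S : R -> R) := [/\ S 0 = 0, S 1 = 0 &
  forall x y, 0 <= x <= 1 -> 0 <= y <= 1 -> `|S y - S x| <= `|y - x|].

Section graph.
Variables (S : R -> R) (HS : lip01 S).
Let F := graph_clamp S.

(** As [S] is [1]-Lipschitz, the slopes of [id + S] lie in [[0, 2]]: both [F] and [2 id - F] are
    nondecreasing, as [stieltjes_dominates] requires. *)
Lemma graph_clamp_lip (x y : R) : x <= y -> 0 <= F y - F x <= 2 * (y - x).
Proof.
move=> xy; have := clamp_lip xy => /andP[c0 c1].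
have [_ _ /(_ _ _ (clamp01 x) (clamp01 y))] := HS.
by rewrite (ger0_norm c0) ler_norml /F /graph_clamp => /andP[]; lra.
Qed.

Lemma lip_continuous (K : R) (f : R -> R) : 0 < K ->
  (forall x y, x <= y -> `|f y - f x| <= K * (y - x)) -> continuous f.
Proof.
move=> K0 fK x; apply/cvgrPdist_lt => e e0 /=; near=> y.
have fK' : `|f x - f y| <= K * `|x - y|.
  have [xy|/ltW yx] := leP x y.
    by rewrite distrC [`|x - y|]distrC (ger0_norm (_ : 0 <= y - x)) ?subr_ge0// fK.
  by rewrite (ger0_norm (_ : 0 <= x - y)) ?subr_ge0// fK.
rewrite (le_lt_trans fK')// mulrC -ltr_pdivlMr//; near: y.
by apply: cvgr_dist_lt => //; exact: divr_gt0.
Unshelve. all: by end_near. Qed.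

Lemma graph_clamp_continuous : continuous F.
Proof.
apply: (@lip_continuous 2) => // x y /graph_clamp_lip/andP[F0 F1].
by rewrite ger0_norm.
Qed.

Lemma graph_clamp_nd : nondecreasing F.
Proof. by move=> x y /graph_clamp_lip/andP[F0 _]; rewrite -subr_ge0. Qed.

Lemma graph_clamp_le0 (x : R) : x <= 0 -> F x = 0.
Proof. by move=> x0; rewrite /F /graph_clamp clamp_le0//; case: HS => -> _ _; rewrite addr0. Qed.

Lemma graph_clamp_ge1 (x : R) : 1 <= x -> F x = 1.
Proof. by move=> x0; rewrite /F /graph_clamp clamp_ge1//; case: HS => _ -> _; rewrite addr0. Qed.

Lemma graph_clamp_cvgNy : F @ -oo --> (0 : R).
Proof.
apply: cvg_near_cst; exists 0; split => // x /= x0.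
by rewrite graph_clamp_le0// ltW.
Qed.

Lemma graph_clamp_cvgy : F @ +oo --> (1 : R).
Proof.
apply: cvg_near_cst; exists 1; split => // x /= x0.
by rewrite graph_clamp_ge1// ltW.
Qed.

(** The Stieltjes measure of [F] has a density [psi], and Lebesgue differentiation of its primitive
    shows that [S] is differentiable almost everywhere with derivative [psi - 1]. The uniqueness
    clause will identify an image measure. *)
Lemma stieltjes_density : exists (nu : {finite_measure set mT -> \bar R}) (psi : R -> R),
  [/\ (forall a b, a <= b -> nu `]a, b]%classic = (F b - F a)%:E) /\
      (forall mu : {measure set mT -> \bar R},
        (forall a b, a <= b -> mu `]a, b]%classic = (F b - F a)%:E) ->
        forall A, measurable A -> nu A = mu A),
      nu [set: mT] = 1%E /\ nu (~` `]0, 1]%classic) = 0%E,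
      measurable_fun [set: R] psi /\ (forall x, 0 <= psi x),
      {ae leb, forall x, 0 < x < 1 -> derivable S x 1 /\ derive1 S x = psi x - 1} &
      forall f : R -> R, measurable_fun [set: R] f -> (forall x, 0 <= f x) ->
       (\int[nu]_x (f x)%:E = \int[leb]_(x in circle) (f x * psi x)%:E)%E].
Proof.
pose cF := isCumulative.Build R _ R F graph_clamp_nd
  (right_continuousW graph_clamp_continuous).
pose bF := isCumulativeBounded.Build R 0 1 F graph_clamp_cvgNy graph_clamp_cvgy.
pose Fb : cumulativeBounded (0 : R) (1 : R) := HB.pack F cF bF.
pose G x := 2 * x - F x.
have G_nd : nondecreasing G.
  by move=> x y /graph_clamp_lip/andP[_ F1]; rewrite /G; lra.
have G_c : continuous G.
  apply: (@lip_continuous 2) => // x y /graph_clamp_lip/andP[F0 F1].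
  by rewrite /G ler_norml; lra.
pose cG := isCumulative.Build R _ R G G_nd (right_continuousW G_c).
pose Gc : cumulative R R := HB.pack G cG.
have dom : lebesgue_stieltjes_measure Fb `<< leb.
  by apply: (@stieltjes_dominates Fb Gc) => x; rewrite /= /G; lra.
pose nu : {finite_measure set mT -> \bar R} := lebesgue_stieltjes_measure Fb.
have nuE a b : a <= b -> nu `]a, b]%classic = (F b - F a)%:E.
  by move=> ab; exact: (lebesgue_stieltjes_itv Fb ab).
have nu1 : nu [set: mT] = 1%E by exact: (@probability_setT _ _ _ (lebesgue_stieltjes_measure Fb)).
pose d := Radon_Nikodym_SigmaFinite.f nu leb.
have d_fin x : d x \is a fin_num by exact: Radon_Nikodym_SigmaFinite.f_fin_num.
have d_int : leb.-integrable [set: mT] d by exact: Radon_Nikodym_SigmaFinite.f_integrable.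
pose psi x := fine (d x).
have dE : d = EFin \o psi by apply/funext => x /=; rewrite fineK.
have psi0 x : 0 <= psi x by apply: fine_ge0; exact: Radon_Nikodym_SigmaFinite.f_ge0.
have mpsi : measurable_fun [set: R] psi.
  by apply/measurable_EFinP; rewrite -dE; exact: measurable_int d_int.
have mI : measurable (`]0%R, 1%R]%classic : set mT) by exact: measurable_itv.
have N0 : nu (~` `]0%R, 1%R]%classic) = 0%E.
  apply: etrans (@probability_setC _ _ _ (lebesgue_stieltjes_measure Fb) _ mI) _.
  rewrite [X in (_ - X)%E](_ : _ = 1%E) ?subee//; apply: etrans (nuE _ _ ler01) _.
  by rewrite (graph_clamp_le0 (lexx 0)) (graph_clamp_ge1 (lexx 1)) subr0.
exists nu, psi; split => //.
- split => // mu muE A mA; apply: (@lebesgue_stieltjes_measure_unique _ Fb mu _ A mA).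
  move=> _ [[a b]] _ <- /=; have [ab|/ltW ba] := leP a b.
    by rewrite muE//; exact: nuE.
  by rewrite set_itv_ge ?bnd_simp -?leNgt// !measure0.
- have ipsi y : leb.-integrable [set` Interval (BRight 0) (BRight y)] (EFin \o psi).
    by rewrite -dE; apply: integrableS d_int.
  have lpsi : locally_integrable [set: R] psi.
    have <- : psi \_ [set: R] = psi by apply/funext => x; rewrite patchE in_setT.
    by apply: integrable_locally => //; rewrite -dE.
  have := FTC1 ipsi lpsi; apply: filterS; first exact: (ae_filter_ringOfSetsType leb).
  move=> x + /andP[x0 x1].
  have ax : (BRight 0%R < BRight x)%O by rewrite bnd_simp.
  move=> /(_ ax); set H := (fun y => _) => - [dH HE].
  (* The primitive [H y] is the mass of []0, y]], that is [F y], which is [y + S y] on [[0, 1]]. *)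
  have SH : {near x, S =1 (fun y => H y - y)}.
    near=> y.
    have y0 : 0 <= y by rewrite ltW//; near: y; exact: lt_nbhsr.
    have y1 : y <= 1 by rewrite ltW//; near: y; exact: lt_nbhsl.
    have -> : H y = F y.
      have := nuE _ _ y0; rewrite (graph_clamp_le0 (lexx 0)) subr0 => nuy.
      rewrite /H /Rintegral -[RHS]/(fine (F y)%:E) -nuy; congr fine.
      by rewrite (Radon_Nikodym_SigmaFinite.f_integral dom)// -/d dE.
    by rewrite /F /graph_clamp clamp_id ?y0// addrC addKr.
  have dHB : derivable (H \- id) x 1 by apply: derivableB => //; exact: derivable_id.
  split.
    by apply: near_eq_derivable dHB; near do apply/esym.
  rewrite derive1E (@near_eq_derive _ _ _ _ _ _ _ SH) (deriveB dH (@derivable_id _ _ _ _)).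
  by rewrite -HE derive1E derive_id.
- move=> f mf f0.
  have mf' : measurable_fun [set: mT] (EFin \o f) by exact/measurable_EFinP.
  have f0' x : (0 <= (EFin \o f) x)%E by rewrite lee_fin.
  (* The measure is carried by []0, 1]], whereas the circle is [[0, 1[]; the endpoints are
     negligible. *)
  rewrite (ge0_negligible_integral (measurableC mI) measurableT mf'
    (fun x _ => f0' x) N0) setTD setCK.
  rewrite -(Radon_Nikodym_SigmaFinite.change_of_variables dom f0')//; last first.
    exact: measurable_funTS.
  rewrite -/d dE.
  have mfp (D : set R) : measurable_fun D (fun x => (f x * psi x)%:E).
    by apply/measurable_EFinP/measurable_funTS; exact: measurable_funM.
  have -> : (\int[leb]_(x in `]0%R, 1%R]) ((EFin \o f) x * (EFin \o psi) x) =
     \int[leb]_(x in `]0%R, 1%R]) (f x * psi x)%:E)%E by [].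
  exact: etrans (integral_itv_bndoo _ _ (mfp _)) (esym (integral_itv_bndoo _ _ (mfp _))).
Unshelve. all: by end_near. Qed.
End graph.

End stieltjes.

(** * Derivative of [S] and change of variables by [id + k S] *)

Section lip_derivative.
Context {R : realType}.
Local Notation leb := (@lebesgue_measure R).
Local Notation mT := (measurableTypeR R).

Lemma lip01_scale (S : R -> R) (k : R) : 0 <= k <= 1 -> lip01 S ->
  lip01 (fun x => k * S x).
Proof.
move=> /andP[k0 k1] [S0 S1 SL]; split; rewrite ?S0 ?S1 ?mulr0// => x y x01 y01.
rewrite -mulrBr normrM (ger0_norm k0) (le_trans _ (SL _ _ x01 y01))//.
by rewrite ler_piMl.
Qed.

Lemma derive1_lip (S : R -> R) (x : R) : lip01 S -> 0 < x < 1 ->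
  derivable S x 1 -> `|derive1 S x| <= 1.
Proof.
move=> [_ _ SL] /andP[x0 x1] dS; rewrite derive1E.
have H : \forall h \near 0^', `|h^-1 *: ((S \o shift x) (h *: 1) - S x)| <= 1.
  near=> h.
  have h0 : h != 0 by near: h; exact: nbhs_dnbhs_neq.
  have hx : 0 <= h + x <= 1.
    have : `|h| < Num.min x (1 - x).
      near: h; apply: dnbhs0_lt; rewrite lt_min x0/=; lra.
    by rewrite lt_min !ltr_norml => /andP[/andP[? ?] /andP[? ?]]; lra.
  rewrite normrZ normfV ler_pdivrMl ?normr_gt0// mulr1 /= scaler1.
  rewrite (le_trans (SL _ _ _ hx)) ?addrK//; lra.
rewrite ler_norml; apply/andP; split.
  by apply: limr_ge => //; apply: filterS H => h; rewrite ler_norml => /andP[].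
by apply: limr_le => //; apply: filterS H => h; rewrite ler_norml => /andP[].
Unshelve. all: by end_near. Qed.

Lemma ae_circle (Q : R -> Prop) : {ae leb, forall x, 0 < x < 1 -> Q x} ->
  {ae leb, forall x, circle x -> Q x}.
Proof.
have ae0 : {ae leb, forall x : R, x != 0}.
  exists [set 0]; split => //; first exact: lebesgue_measure_set1.
  by move=> x /= /negP; rewrite negbK => /eqP.
have af := ae_filter_ringOfSetsType leb.
apply: filterS2 ae0 => x x0 Qx; rewrite /circle/= in_itv/= => /andP[x0' x1].
by apply: Qx; rewrite lt_neqAle eq_sym x0 x0'.
Qed.

Lemma measure_setI_full (nu : {measure set mT -> \bar R}) (A B : set mT) :
  measurable A -> measurable B -> nu (~` B) = 0%E -> nu A = nu (A `&` B).
Proof.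
move=> mA mB nB; rewrite (measureDI _ mA mB).
rewrite [X in (X + _)%E](_ : _ = 0%E) ?add0e//.
by apply: (subset_measure0 _ (measurableC mB) _ nB); [exact: measurableD|move=> x []].
Qed.

(* The image by [graph_clamp] of the Stieltjes measure of [D = id + S] is the
   Lebesgue measure of the circle, the Stieltjes measure of [id]. *)
Lemma graph_clamp_pushforward (S : R -> R) (k : R)
    (nu : {finite_measure set mT -> \bar R}) :
  0 <= k < 1 -> lip01 S ->
  let F := graph_clamp (fun x => k * S x) in
  (forall a b, a <= b -> nu `]a, b]%classic = (F b - F a)%:E) ->
  nu (~` `]0, 1]%classic) = 0%E ->
  forall a b : R, a <= b ->
    nu (F @^-1` `]a, b]%classic) = (clamp b - clamp a)%:E.
Proof.
move=> /andP[k0 k1] HS F nuE nu0' a b ab.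
have HkS : lip01 (fun x => k * S x) by apply: lip01_scale => //; rewrite k0 ltW.
have F_id x : 0 <= x <= 1 -> F x = x + k * S x.
  by move=> x01; rewrite /F /graph_clamp clamp_id.
have F_cont := graph_clamp_continuous HkS.
have F0 : F 0 = 0 by apply: graph_clamp_le0.
have F1 : F 1 = 1 by apply: graph_clamp_ge1.
(* Strict monotonicity: for [y < x], the increment [F x - F y] is at least [(1 - k) * (x - y)],
   which is positive because [k < 1]. *)
have F_mono x y : 0 <= x <= 1 -> 0 <= y <= 1 -> (F x <= F y) = (x <= y).
  move=> x01 y01; have [xy|yx] := leP x y; first exact: graph_clamp_nd.
  apply/negbTE; rewrite -ltNge !F_id//.
  have [_ _ /(_ _ _ y01 x01)] := HS.
  rewrite (gtr0_norm (_ : 0 < x - y)) ?subr_gt0// ler_norml => /andP[SS _].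
  have : k * (y - x) <= k * (S x - S y) by rewrite ler_wpM2l//; lra.
  have : (1 - k) * (x - y) > 0 by rewrite mulr_gt0 ?subr_gt0.
  by lra.
have F01 x : 0 <= F x <= 1.
  have c01 := clamp01 x; have -> : F x = F (clamp x).
    by rewrite /F /graph_clamp (clamp_id c01).
  by rewrite -{1}F0 -F1 !F_mono ?lexx ?ler01.
have F_onto v : exists2 c, 0 <= c <= 1 & F c = clamp v.
  have := @IVT _ F 0 1 (clamp v) ler01 (continuous_subspaceT F_cont).
  rewrite F0 F1 (min_idPl ler01) (max_idPr ler01) => /(_ (clamp01 v))[c].
  by rewrite in_itv/= => c01 Fc; exists c.
(* Within []0, 1]], the preimage of []a, b]] is []al, be]], to which [nu] gives the mass
   [F be - F al]. *)
have [al al01 Fal] := F_onto a; have [be be01 Fbe] := F_onto b.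
have cab : clamp a <= clamp b by have := clamp_lip ab; rewrite subr_ge0 => /andP[].
have albe : al <= be by rewrite -F_mono// Fal Fbe.
have mF : measurable_fun [set: R] F by exact: continuous_measurable_fun.
rewrite -Fal -Fbe -nuE//.
have mI : measurable (`]0, 1]%classic : set mT) by exact: measurable_itv.
have mFab : measurable (F @^-1` `]a, b]%classic : set mT).
  by rewrite -[X in measurable X]setTI; exact: mF.
apply: etrans (measure_setI_full mFab mI nu0') _.
congr (nu _); apply/seteqP; split => x /=; rewrite !in_itv/=.
  move=> [/andP[aF Fb] /andP[x0 x1]]; have x01 : 0 <= x <= 1 by rewrite ltW.
  have Fx : F x = clamp (F x) by rewrite clamp_id.
  have x0' : 0 < F x by rewrite -F0 ltNge F_mono ?lexx ?ler01// -ltNge.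
  apply/andP; split.
    rewrite ltNge -F_mono// -ltNge Fal /clamp gt_max x0'/=.
    by rewrite gt_min aF.
  rewrite -F_mono// Fbe /clamp le_max le_min Fb; have /andP[_ ->] := F01 x.
  by rewrite orbT.
move=> /andP[alx xbe]; have x01 : 0 <= x <= 1.
  by move: al01 be01 => /andP[? _] /andP[_ ?]; lra.
have aFx : clamp a < F x by rewrite -Fal ltNge F_mono// -ltNge.
have Fxb : F x <= clamp b by rewrite -Fbe F_mono.
apply/and_comm; split.
  by move: al01 => /andP[? _]; move: x01 => /andP[_ ->]; rewrite andbT; lra.
move: aFx Fxb; rewrite /clamp gt_max gt_min le_max le_min => /andP[Fx0 aFx].
rewrite leNgt Fx0/= => /andP[-> _]; rewrite andbT.
by move: aFx => /orP[//|]; have /andP[_ F1x] := F01 x; rewrite ltNge F1x.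
Qed.


(** The zero mean says that [1 + s] is the density of a measure of mass [1]. The change of variables
    compares two measures: the image by [id + k S] of the measure of density [1 + k s], and the
    Lebesgue measure of the circle. *)
Lemma lip_derivative (S : R -> R) : lip01 S -> exists s : R -> R,
  [/\ measurable_fun [set: R] s, forall x, `|s x| <= 1,
      {ae leb, forall x, circle x -> derivable S x 1 /\ derive1 S x = s x},
      \int[leb]_(x in circle) s x = 0 &
      forall (k : R) (f : R -> R), 0 <= k < 1 -> measurable_fun [set: R] f ->
        (forall x, 0 <= f x) ->
        \int[leb]_(x in circle) (f (x + k * S x) * (1 + k * s x)) =
        \int[leb]_(x in circle) f x].
Proof.
move=> HS.
have [nu [psi [_ [nu1 _] [mpsi psi0] aepsi nuint]]] := stieltjes_density HS.
have mC : measurable (@circle R) by exact: measurable_circle.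
(* The truncation gives a bound at every point; it changes nothing where [S] is differentiable with
   derivative [psi - 1]. *)
pose s x := if `|psi x - 1| <= 1 then psi x - 1 else 0.
have ms : measurable_fun [set: R] s.
  have mp1 : measurable_fun [set: R] (fun x => psi x - 1) by exact: measurable_funB.
  apply: measurable_fun_ifT => //; apply: measurable_fun_ler => //.
  exact: measurableT_comp.
have s1 x : `|s x| <= 1 by rewrite /s; case: ifPn => //; rewrite normr0.
have aes : {ae leb, forall x, circle x -> derivable S x 1 /\ derive1 S x = s x}.
  apply: ae_circle; apply: filterS aepsi; first exact: (ae_filter_ringOfSetsType leb).
  move=> x H x01; have [dS DS] := H x01; split => //.
  by rewrite /s -DS (derive1_lip HS x01 dS).
have af := ae_filter_ringOfSetsType leb.
have ae1 : {ae leb, forall x, circle x -> psi x = 1 + s x}.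
  apply: filterS2 (ae_circle aepsi) aes => x H1 H2 cx.
  by have [_ <-] := H2 cx; have [_ ->] := H1 cx; rewrite addrC subrK.
have bs : bmf 1 s by split; [exact: measurable_funTS|].
exists s; split => //.
  have : (\int[leb]_(x in circle) (1 + s x)%:E = 1)%E.
    transitivity (\int[leb]_(x in circle) (1 * psi x)%:E)%E.
      apply: ae_eq_integral => //.
      - by apply/measurable_EFinP/measurable_funTS; exact: measurable_funD.
      - by apply/measurable_EFinP/measurable_funTS; exact: measurable_funM.
      - by apply: filterS ae1 => x + cx => /(_ cx) ->; rewrite mul1r.
    rewrite -(nuint (cst 1))//; apply: etrans (integral_cst _ measurableT 1%E) _.
    exact: etrans (mul1e _) nu1.
  move=> H; apply: (@addrI _ 1); rewrite addr0 -{1}(Rintegral_circle_cst 1).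
  by rewrite -(RintegralDc (bmf_cst 1) bs) /Rintegral H.
move=> k f k01 mf f0; have /andP[k0 k1] := k01.
have HkS : lip01 (fun x => k * S x) by apply: lip01_scale => //; rewrite k0 ltW.
(* The case [0 * S] presents the Lebesgue measure of the circle as a Stieltjes measure, so that the
   uniqueness clause applies to it. *)
have H0S : lip01 (fun x => 0 * S x) by apply: lip01_scale => //; rewrite lexx ler01.
have [nuk [psik [[nukE _] [_ nuk0] [mpsik _] aek nukint]]] := stieltjes_density HkS.
have [nuz [psiz [[_ nuzU] _ [mpsiz _] aez nuzint]]] := stieltjes_density H0S.
have dk (l : R) (p : R -> R) : {ae leb, forall x, 0 < x < 1 ->
     derivable (fun x => l * S x) x 1 /\ derive1 (fun x => l * S x) x = p x - 1} ->
   {ae leb, forall x, circle x -> p x = 1 + l * s x}.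
  move=> aep; apply: filterS2 (ae_circle aep) aes => x H1 H2 cx.
  have [_ D1] := H1 cx; have [dS D2] := H2 cx.
  have : p x - 1 = l * s x.
    rewrite -D1 -D2 !derive1E; exact: (deriveZ l dS).
  by move=> <-; rewrite addrC subrK.
have {}aek := dk _ _ aek; have {}aez := dk _ _ aez.
pose F := graph_clamp (fun x => k * S x).
have mF : measurable_fun [set: R] F.
  by apply: continuous_measurable_fun; exact: graph_clamp_continuous.
congr fine; apply/esym.
transitivity (\int[leb]_(x in circle) (f x * psiz x)%:E)%E.
  apply: ae_eq_integral => //.
  - by apply/measurable_EFinP/measurable_funTS.
  - by apply/measurable_EFinP/measurable_funTS; exact: measurable_funM.
  - by apply: filterS aez => x + cx => /(_ cx) ->; rewrite mul0r addr0 mulr1.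
rewrite -nuzint//.
transitivity (\int[nuk]_x (f (F x))%:E)%E.
  have mf' : measurable_fun [set: mT] (EFin \o f) by exact/measurable_EFinP.
  have f0' x : (0 <= (EFin \o f) x)%E by rewrite lee_fin.
  have := @ge0_integral_pushforward _ _ mT mT R F mF nuk setT (EFin \o f) measurableT mf'.
  move=> /(_ (fun x _ => f0' x)); rewrite preimage_setT => <-.
  apply: eq_measure_integral => A mA _.
  apply: nuzU => // a b ab; rewrite /graph_clamp !mul0r !addr0.
  exact: (graph_clamp_pushforward k01 HS nukE nuk0 ab).
rewrite (nukint (f \o F)) => [||x]; last 2 first.
- exact: measurableT_comp.
- exact: f0.
have FE x : circle x -> F x = x + k * S x.
  rewrite /circle/= in_itv/= => /andP[x0 x1].
  by rewrite /F /graph_clamp clamp_id ?x0 ?ltW.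
rewrite (@eq_integral _ _ _ leb circle (fun x => (f (F x) * (1 + k * s x))%:E)
   (fun x => (f (x + k * S x) * (1 + k * s x))%:E)); last first.
  by move=> x /set_mem cx; rewrite FE.
apply: ae_eq_integral => //.
- apply/measurable_EFinP/measurable_funTS; apply: measurable_funM => //.
  exact: measurableT_comp.
- apply/measurable_EFinP/measurable_funTS; apply: measurable_funM => //.
    exact: measurableT_comp.
  by apply: measurable_funD => //; exact: measurable_funM.
- by apply: filterS aek => x + cx => /(_ cx) ->.
Qed.

End lip_derivative.

(** * Integrals of functions not known to be measurable *)

Section ae_integral.
Context {R : realType}.
Local Notation leb := (@lebesgue_measure R).
Local Notation mT := (measurableTypeR R).

(** The integral of a nonnegative function is a supremum over the simple functions below it, hence
    monotone even without measurability. *)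
Lemma ge0_le_integral_arbitrary (D : set mT) (f g : mT -> \bar R) :
  (forall x, D x -> (0 <= f x <= g x)%E) ->
  (\int[leb]_(x in D) f x <= \int[leb]_(x in D) g x)%E.
Proof.
move=> fg; rewrite !ge0_integralE; last 2 first.
- by move=> x /fg/andP[f0]; exact: le_trans.
- by move=> x /fg/andP[].
apply: le_ereal_sup => _ [h hf <-]; exists h => // x.
apply: le_trans (hf x) _; rewrite !patchE; case: ifPn => // /set_mem Dx.
by have /andP[] := fg _ Dx.
Qed.

(* [f] need not be measurable: it is squeezed between the modifications of [g]
   by [0] and [+oo] on a negligible set. *)
Lemma ae_eq_integral_arbitrary (D : set mT) (f g : mT -> \bar R) :
  measurable D -> measurable_fun D g ->
  {ae leb, forall x, D x -> f x = g x} ->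
  (\int[leb]_(x in D) f x = \int[leb]_(x in D) g x)%E.
Proof.
move=> mD; wlog [f0 g0] : f g / (forall x, 0 <= f x)%E /\ (forall x, 0 <= g x)%E.
  move=> H mg fg; rewrite integralE [RHS]integralE; congr (_ - _)%E; apply: H.
  - by split => x; exact: funepos_ge0.
  - exact: measurable_funepos.
  - by apply: filterS fg => x + Dx => /(_ Dx) fgx; rewrite !funeposE fgx.
  - by split => x; exact: funeneg_ge0.
  - exact: measurable_funeneg.
  - by apply: filterS fg => x + Dx => /(_ Dx) fgx; rewrite !funenegE fgx.
move=> mg [N [mN N0 Nfg]].
have fgN x : D x -> x \notin N -> f x = g x.
  move=> Dx /negP xN; apply: contrapT => fgx; apply: xN; apply/mem_set/Nfg => /=.
  by move/(_ Dx).
have aeN (h : mT -> \bar R) (c : \bar R) : h = (fun x => if x \in N then c else g x) ->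
    (\int[leb]_(x in D) h x = \int[leb]_(x in D) g x)%E.
  move=> ->; apply: ae_eq_integral => //.
    apply: measurable_fun_if => //.
    - apply: (measurable_fun_bool true).
      rewrite (_ : _ @^-1` _ = N); first exact: measurableI.
      by apply/seteqP; split => x /=; [move/set_mem|move/mem_set].
    - by apply: measurable_funS mg => //; exact: subIsetl.
  exists N; split => // x /= H; apply: contrapT => xN; apply: H => Dx.
  by rewrite memNset.
apply/eqP; rewrite eq_le; apply/andP; split.
  rewrite -(aeN _ +oo%E erefl); apply: ge0_le_integral_arbitrary => x Dx.
  by rewrite f0/=; case: ifPn => [_|/(fgN _ Dx) ->]//; exact: leey.
rewrite -(aeN _ 0%E erefl); apply: ge0_le_integral_arbitrary => x Dx.
by case: ifPn => [_|/(fgN _ Dx) ->]; rewrite ?lexx ?g0 ?f0.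
Qed.

(** Where [S] is not differentiable, [derive1] has an uncontrolled value, so the integrand on the
    left is not known to be measurable. *)
Lemma conv_derive (rho S s P : R -> R) (M V : R) :
  noise_kernel (rho \o circle_proj) M P V ->
  measurable_fun [set: R] s ->
  {ae leb, forall x, circle x -> derivable S x 1 /\ derive1 S x = s x} ->
  conv rho (derive1 (\- S)) = cconv (rho \o circle_proj) (fun x => - s x).
Proof.
move=> nk ms aes; apply/funext => x; rewrite /conv /cconv; congr fine.
apply: ae_eq_integral_arbitrary; first exact: measurable_circle.
  apply/measurable_EFinP/measurable_funTS; apply: measurable_funM.
    by apply: (measurableT_comp (nk_measurable nk)); exact: measurable_subl.
  exact: measurable_funN.
apply: filterS aes; first exact: (ae_filter_ringOfSetsType leb).
move=> y + cy => /(_ cy)[dS DS]; congr (_ * _)%:E.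
by rewrite derive1E deriveN// -derive1E DS.
Qed.

End ae_integral.

(** * Linear response *)

Section response.
Context {R : realType}.
Local Notation leb := (@lebesgue_measure R).
Local Notation mT := (measurableTypeR R).

Lemma L1norm_le (B : R) (w : R -> R) : bmf B w -> (0 <= L1norm w <= B%:E)%E.
Proof.
move=> wB; have bn : bmf B (fun x => `|w x|).
  case: wB => mw hw; split; first exact: measurableT_comp.
  by move=> y cy; rewrite normr_id hw.
apply/andP; split; first by apply: integral_ge0 => x _; rewrite lee_fin.
rewrite /L1norm -EFin_Rintegral; last 2 first.
- exact: bmf_integrable bn.
- exact: measurable_circle.
by rewrite lee_fin (le_trans (ler_norm _)) ?(bmf_Rintegral_le bn).
Qed.

Lemma L1norm_ae (u w : R -> R) : measurable_fun circle w ->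
  {ae leb, forall x, circle x -> u x = w x} -> L1norm u = L1norm w.
Proof.
move=> mw uw; apply: ae_eq_integral_arbitrary; first exact: measurable_circle.
  by apply/measurable_EFinP; exact: measurableT_comp.
apply: filterS uw; first exact: (ae_filter_ringOfSetsType leb).
by move=> x + cx => /(_ cx) ->.
Qed.

Variables (theta : R) (rho : R -> R) (M : R) (P : R -> R) (V : R).
Let r := rho \o circle_proj.
Hypothesis nk : noise_kernel r M P V.
Let rt (x : R) := r (x - theta).
Let nkt : noise_kernel rt M (fun x => P (x - theta)) V := noise_kernel_shift theta nk.

Variables (S : R -> R).
Hypothesis HS : lip01 S.

Lemma lip01_bound (x : R) : 0 <= x <= 1 -> `|S x| <= x /\ `|S x| <= 1 - x.
Proof.
move=> x01; have /andP[x0 x1] := x01; have [S0 S1 SL] := HS.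
have z01 : 0 <= (0 : R) <= 1 by lra.
have o01 : 0 <= (1 : R) <= 1 by lra.
have H0 := SL _ _ z01 x01; have H1 := SL _ _ x01 o01.
move: H0 H1.
by rewrite S0 S1 subr0 sub0r normrN subr0 (ger0_norm x0) (ger0_norm (_ : 0 <= 1 - x)) ?subr_ge0.
Qed.

Lemma perturbation_circle (k x : R) : 0 <= k < 1 -> circle x ->
  circle (perturbation S k x).
Proof.
move=> /andP[k0 k1]; rewrite /circle/= !in_itv/= => /andP[x0 x1].
have [|Sx Sx1] := @lip01_bound x; first by rewrite x0 ltW.
rewrite /perturbation.
have kS : `|k * S x| <= k * x.
  by rewrite normrM (ger0_norm k0) ler_wpM2l.
have kS1 : `|k * S x| <= k * (1 - x).
  by rewrite normrM (ger0_norm k0) ler_wpM2l.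
have : k * x <= x by rewrite ler_piMl// ltW.
have : k * (1 - x) < 1 - x by rewrite gtr_pMl ?subr_gt0.
by move: kS kS1; rewrite !ler_norml; lra.
Qed.

(** Nothing is known of [S] outside [[0, 1]]; the continuous function [graph_clamp] stands in for
    [D] when measurability on the line is at stake. *)
Lemma perturbation_graph_clamp (k x : R) : circle x ->
  perturbation S k x = graph_clamp (fun y => k * S y) x.
Proof.
rewrite /circle/= in_itv/= => /andP[x0 x1].
by rewrite /graph_clamp clamp_id// x0 ltW.
Qed.

Lemma measurable_graph_clamp (k : R) : 0 <= k < 1 ->
  measurable_fun [set: R] (graph_clamp (fun y => k * S y)).
Proof.
move=> /andP[k0 k1]; apply: continuous_measurable_fun.
by apply: graph_clamp_continuous; apply: lip01_scale => //; rewrite k0 ltW.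
Qed.

Lemma measurable_perturbed_rotation (k : R) : 0 <= k < 1 ->
  measurable_fun [set: R] (perturbed_rotation theta S k).
Proof.
move=> k01; rewrite (_ : perturbed_rotation _ _ _ =
    graph_clamp (fun y => k * S y) \o rotation theta).
  apply: measurableT_comp; first exact: measurable_graph_clamp.
  exact: measurable_rotation.
apply/funext => x; rewrite /perturbed_rotation /= perturbation_graph_clamp//.
exact: rotation_circle.
Qed.

Lemma measurable_perturbation (k : R) : 0 <= k < 1 ->
  measurable_fun circle (perturbation S k).
Proof.
move=> k01; apply: (@eq_measurable_fun _ _ _ _ _ (graph_clamp (fun y => k * S y))).
  by move=> x /set_mem cx; apply/esym/perturbation_graph_clamp.
by apply: measurable_funTS; exact: measurable_graph_clamp.
Qed.

Variables (k B : R) (g : R -> R).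
Hypotheses (k01 : 0 <= k < 1) (gB : bmf B g) (mg : measurable_fun [set: R] g).
Hypothesis g1 : forall x, g (x + 1) = g x.
Hypothesis gE : forall x, g x =
  \int[leb]_(y in circle) (r (x - perturbed_rotation theta S k y) * g y).

(** The density after the rotation: [g] and [L g] become integrals of the same [gt], against
    [r (x - D y)] and [r (x - y)]. *)
Let gt (y : R) := g (y - theta).

Lemma bmf_gt : bmf B gt.
Proof.
split; first by apply: measurable_funTS; apply: (measurableT_comp mg); exact: measurable_funB.
move=> x _; rewrite /gt -(periodic_proj g1).
by case: gB => _; apply; exact: circle_projP.
Qed.

Lemma fixed_density_shift (x : R) :
  g x = \int[leb]_(y in circle) (r (x - perturbation S k y) * gt y).
Proof.
pose G y := r (x - graph_clamp (fun y => k * S y) (circle_proj y)) * gt y.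
have mG : measurable_fun [set: R] G.
  apply: measurable_funM; last by apply: (measurableT_comp mg); exact: measurable_funB.
  apply: (measurableT_comp (nk_measurable nk)); apply: measurable_funB => //.
  apply: measurableT_comp; first exact: measurable_graph_clamp.
  exact: measurable_circle_proj.
have G1 y : G (y + 1) = G y.
  by rewrite /G circle_projD1 /gt addrAC g1.
transitivity (\int[leb]_(y in circle) G (y + theta)).
  rewrite gE; apply: eq_RintegralP => y _; rewrite /G /gt addrK.
  by rewrite -perturbation_graph_clamp//; exact: circle_projP.
rewrite periodic_RintegralD//; apply: eq_RintegralP => y cy.
by rewrite /G circle_proj_id// perturbation_graph_clamp.
Qed.

Lemma cconv_shift (x : R) :
  cconv rt g x = \int[leb]_(y in circle) (r (x - y) * gt y).
Proof.
pose G y := r (x - y) * gt y.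
have mG : measurable_fun [set: R] G.
  apply: measurable_funM; last by apply: (measurableT_comp mg); exact: measurable_funB.
  by apply: (measurableT_comp (nk_measurable nk)); exact: measurable_funB.
have G1 y : G (y + 1) = G y.
  rewrite /G /gt addrAC g1; congr (_ * _).
  by rewrite -[LHS](nk_periodic nk); congr r; ring.
rewrite -[RHS](periodic_RintegralD theta mG G1).
apply: eq_RintegralP => y _; rewrite /G /gt addrK /rt; congr (r _ * _).
by ring.
Qed.

Lemma perturbation_close (x y : R) : circle y ->
  `|x - perturbation S k y - (x - y)| <= k.
Proof.
rewrite /circle/= in_itv/= => /andP[y0 y1]; have /andP[k0 _] := k01.
rewrite /perturbation (_ : _ - _ = - (k * S y)); last by ring.
rewrite normrN normrM (ger0_norm k0) ler_piMr//.
have [|Sy _] := @lip01_bound y; first by rewrite y0 ltW.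
by rewrite (le_trans Sy)// ltW.
Qed.

Lemma defect_bound (A : R) (w : R -> R) (x : R) : bmf A w ->
  `|\int[leb]_(y in circle) (r (x - perturbation S k y) * w y) -
    \int[leb]_(y in circle) (r (x - y) * w y)| <= 2 * k * V * A.
Proof.
have /andP[k0 _] := k01.
move=> wA; apply: (kernel_close nk k0 _ _ _ _ wA).
- by apply: measurable_funB => //; exact: measurable_perturbation.
- exact: measurable_subl.
- by move=> y; exact: perturbation_close.
- by move=> y _; rewrite subrr normr0.
Qed.

Variable K : R.
Hypothesis HK : forall (A E : R) w, bmf A w ->
  \int[leb]_(x in circle) w x = 0 ->
  (forall x, circle x -> `|w x - cconv rt w x| <= E) -> bmf (K * E) w.
Hypothesis gint : \int[leb]_(x in circle) g x = 1.

Lemma density_close : bmf (K * (2 * k * V * B)) (fun x => g x - 1).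
Proof.
have b1 : bmf `|1| (cst 1 : R -> R) by exact: bmf_cst.
apply: (HK (bmfB gB b1)).
  by rewrite (RintegralBc gB b1) gint Rintegral_circle_cst subrr.
move=> x _; rewrite (cconvB nkt _ gB b1) (cconv_cst nkt).
rewrite opprB addrA subrK cconv_shift {1}fixed_density_shift.
exact: defect_bound bmf_gt.
Qed.

Variables (s : R -> R).
Hypothesis (ms : measurable_fun [set: R] s) (s1 : forall x, `|s x| <= 1).
Hypothesis svar : forall f : R -> R, measurable_fun [set: R] f -> (forall x, 0 <= f x) ->
  \int[leb]_(x in circle) (f (x + k * S x) * (1 + k * s x)) =
  \int[leb]_(x in circle) f x.

Let v := cconv r (fun x => - s x).

(** Two errors of order [k ^ 2]: the kernel difference acting on [gt - 1], small by [density_close],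
    and [k] times the kernel difference acting on [- s]. *)
Lemma defect_expansion (x : R) :
  `|g x - cconv rt g x - k * v x| <=
  k * (2 * V * (K * (2 * k * V * B)) + 2 * V * k).
Proof.
have /andP[k0 _] := k01.
set C := K * (2 * k * V * B).
have bgt1 : bmf C (fun y => gt y - 1).
  have [m1 h1] := density_close; split.
    apply: measurable_funB => //; exact: (bmf_gt).1.
  by move=> y _; rewrite /gt -(periodic_proj g1) h1//; exact: circle_projP.
have b1 : bmf `|1| (cst 1 : R -> R) by exact: bmf_cst.
have bs : bmf 1 s by split; [exact: measurable_funTS|].
have bsN := bmfN bs.
have bk : bmf M (fun y => r (x - y)) by exact: (bmf_kernel nk (@measurable_subl _ _ x)).
have bD : bmf M (fun y => r (x - perturbation S k y)).
  by apply: (bmf_kernel nk); apply: measurable_funB => //; exact: measurable_perturbation.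
pose ID w := \int[leb]_(y in circle) (r (x - perturbation S k y) * w y).
pose I w := \int[leb]_(y in circle) (r (x - y) * w y).
have split_gt (u : R -> R) : bmf M u ->
    \int[leb]_(y in circle) (u y * gt y) =
    \int[leb]_(y in circle) (u y * (gt y - 1)) + \int[leb]_(y in circle) u y.
  move=> bu; rewrite -(RintegralDc (bmfM bu bgt1) bu).
  by apply: eq_RintegralP => y _; ring.
have gx : g x = ID (fun y => gt y - 1) + \int[leb]_(y in circle) r (x - perturbation S k y).
  by rewrite fixed_density_shift (split_gt _ bD).
have Lx : cconv rt g x = I (fun y => gt y - 1) + \int[leb]_(y in circle) r (x - y).
  by rewrite cconv_shift (split_gt _ bk).
(* The change of variables rewrites the left side with the kernel [r (x - D y)] and the weight
   [1 + k s]. *)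
have cv : \int[leb]_(y in circle) r (x - y) =
    \int[leb]_(y in circle) r (x - perturbation S k y) - k * ID (fun y => - s y).
  rewrite -(svar (f := fun z => r (x - z))); last 2 first.
  - by apply: (measurableT_comp (nk_measurable nk)); exact: measurable_subl.
  - by move=> z; exact: nk_ge0 nk _.
  rewrite -(RintegralZc _ (bmfM bD bsN)).
  rewrite -(RintegralBc bD (bmfM (bmf_cst k) (bmfM bD bsN))).
  by apply: eq_RintegralP => y _; rewrite /perturbation /=; ring.
have d1 := defect_bound x bgt1; have d2 := defect_bound x bsN.
rewrite gx Lx cv.
have -> : ID (fun y => gt y - 1) + \int[leb]_(y in circle) r (x - perturbation S k y) -
  (I (fun y => gt y - 1) + (\int[leb]_(y in circle) r (x - perturbation S k y) -
     k * ID (fun y => - s y))) - k * v x =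
  (ID (fun y => gt y - 1) - I (fun y => gt y - 1)) +
   k * (ID (fun y => - s y) - I (fun y => - s y)).
  by rewrite -[v x]/(I (fun y => - s y)); ring.
rewrite (le_trans (ler_normD _ _))// [leRHS]mulrDr lerD//.
  by rewrite (le_trans d1)// le_eqVlt; apply/orP; left; apply/eqP; ring.
rewrite normrM (ger0_norm k0) ler_wpM2l// (le_trans d2)// mulr1.
by rewrite le_eqVlt; apply/orP; left; apply/eqP; ring.
Qed.

(** Since [L] fixes constants and [h - L h = v], the defect of [(g - 1) / k - h] is the remainder of
    [defect_expansion] divided by [k]. *)
Lemma response_bound (h : R -> R) (A : R) : 0 < k -> bmf A h ->
  \int[leb]_(x in circle) h x = 0 ->
  (forall x, circle x -> h x - cconv rt h x = v x) ->
  bmf (K * (2 * V * (K * (2 * k * V * B)) + 2 * V * k))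
    (fun x => (g x - 1) / k - h x).
Proof.
move=> kgt0 hA h0 hv.
have b1 : bmf `|1| (cst 1 : R -> R) by exact: bmf_cst.
have bg1 := bmfB gB b1.
have bgk := bmfM (bmf_cst k^-1) bg1.
rewrite (_ : (fun x => _) = (fun x => k^-1 * (g x - 1) - h x)); last first.
  by apply/funext => x; rewrite mulrC.
apply: (HK (bmfB bgk hA)).
  rewrite (RintegralBc bgk hA) (RintegralZc _ bg1) (RintegralBc gB b1).
  by rewrite gint Rintegral_circle_cst h0; ring.
move=> x cx; rewrite (cconvB nkt _ bgk hA) (cconvZ nkt _ _ bg1).
rewrite (cconvB nkt _ gB b1) (cconv_cst nkt).
have -> : k^-1 * (g x - 1) - h x - (k^-1 * (cconv rt g x - 1) - cconv rt h x) =
   k^-1 * (g x - cconv rt g x - k * v x).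
  rewrite -(hv _ cx); move: (g x) (h x) (cconv rt g x) (cconv rt h x) => a b c d.
  by field; rewrite gt_eqF.
rewrite normrM gtr0_norm ?invr_gt0// ler_pdivrMl//.
exact: defect_expansion.
Qed.

End response.

(** * From bounded functions to the statement on densities *)

Section stationary_response.
Context {R : realType}.
Local Notation leb := (@lebesgue_measure R).
Local Notation mT := (measurableTypeR R).

Lemma is_density_restr (nu : set mT -> \bar R) (B : R) (g : R -> R) : bmf B g ->
  (forall A : set mT, measurable A ->
    nu A = \int[leb]_(x in circle `&` A) (g x)%:E)%E -> is_density nu g.
Proof.
move=> gB nuE; split; first exact: bmf_integrable gB.
by move=> A mA AC; rewrite nuE// setIidr.
Qed.

Lemma is_resolvent_exists (theta : R) (rho : R -> R) (M : R) (P : R -> R) (V B : R)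
    (v : R -> R) : noise_kernel (rho \o circle_proj) M P V ->
  bmf B v -> \int[leb]_(x in circle) v x = 0 ->
  exists (h : R -> R) (A : R), [/\ bmf A h, \int[leb]_(x in circle) h x = 0,
    forall x, circle x ->
      h x - cconv (fun x => (rho \o circle_proj) (x - theta)) h x = v x &
    is_resolvent (noisy_transfer (rotation theta) rho) v h].
Proof.
move=> nk vB v0; have nkt := noise_kernel_shift theta nk.
have [h [A [e [hA h0 hv e0 he]]]] := resolvent_exists nkt vB v0.
exists h, A; split => //.
have iterE n : iter n (noisy_transfer (rotation theta) rho) v =
    iter n (cconv (fun x => (rho \o circle_proj) (x - theta))) v.
  elim: n => //= n ->; apply: (noisy_transfer_rotation theta nk (B := B)).
  exact: (bmf_iter nkt n vB).
split; [exact: bmf_integrable vB|exact: v0|exact: bmf_integrable hA|].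
apply: (@squeeze_cvge _ _ _ _ (cst 0%E) _ (EFin \o e)); last 2 first.
- exact: cvg_cst.
- by apply/cvg_EFin => //; exact: nearW.
near=> n; apply: L1norm_le; split; last first.
  move=> x cx; have := he n x cx; congr (`|_ - _| <= _).
  by apply: eq_bigr => k _; rewrite iterE.
apply: measurable_funB; last by case: hA.
apply: measurable_sum => k; rewrite iterE.
by case: (bmf_iter nkt k vB).
Unshelve. all: by end_near. Qed.

End stationary_response.

Theorem mainTheorem17 (R : realType) (theta : R)
    (theta_irrational : irrational theta)
    (theta_type : (2%:E < diophantine_type theta)%E)
    (rho : R -> R)
    (rho_density : probability_density rho)
    (rho_BV : bounded_variation 0 1 rho)
    (S : R -> R)
    (S_lipschitz : 1.-lipschitz_`[0, 1] S)
    (S0 : S 0 = 0) (S1 : S 1 = 0)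
    (S_support : support_finite_union_itv S)
    (dbar : R) (dbar_gt0 : 0 < dbar)
    (D_homeo : forall delta : R, 0 <= delta < dbar ->
       bilipschitz_homeomorphism (perturbation S delta))
    (f : R -> {measure set (measurableTypeR R) -> \bar R})
    (f_probability : forall delta : R, 0 <= delta < dbar ->
       circle_probability (f delta))
    (f_fixed : forall delta : R, 0 <= delta < dbar ->
       stationary (perturbed_rotation theta S delta) rho (f delta)) :
  [/\ circle_probability (@circle_leb R),
      stationary (rotation theta) rho circle_leb,
      (forall mu : {measure set (measurableTypeR R) -> \bar R},
         circle_probability mu -> stationary (rotation theta) rho mu ->
         forall A : set (measurableTypeR R), measurable A ->
           mu A = circle_leb A) &
      exists h : R -> R,
        is_resolvent (noisy_transfer (rotation theta) rho)
          (conv rho (derive1 (\- S))) h /\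
        L1norm (fun x =>
            (density (f delta) x - density circle_leb x) / delta - h x)
          @[delta --> 0^'+] --> 0%E].
Proof.
have [M [P [V nk]]] := noise_kernel_bv rho_density rho_BV.
have nkt := noise_kernel_shift theta nk.
have HS : lip01 S.
  split => // x y x01 y01; have := S_lipschitz (y, x); rewrite /= mul1r; apply.
  by split; rewrite /= in_itv.
have [s [ms s1 aes s_int svar]] := lip_derivative HS.
have bs : bmf 1 s by split; [exact: measurable_funTS|].
have vE := conv_derive nk ms aes.
have bv := bmf_cconv nk (bmfN bs).
have v0 : \int[lebesgue_measure]_(x in circle)
    cconv (rho \o circle_proj) (fun x => - s x) x = 0.
  rewrite (cconv_mean nk (bmfN bs)).
  transitivity (\int[lebesgue_measure]_(x in circle) (-1 * s x)).
    by apply: eq_RintegralP => x _; rewrite mulN1r.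
  by rewrite (RintegralZc _ bs) s_int mulr0.
split; [exact: circle_leb_probability|exact: (circle_leb_stationary theta nk)
  |exact: (rotation_stationary_unique nk)|].
have [h [A [hA h0 hv hres]]] := is_resolvent_exists theta nk bv v0.
exists h; split; first by rewrite vE.
have [K K0 HK] := resolvent_bound nkt.
(* The constant of [response_bound] with [B = M], after factoring out [delta]. *)
pose C := K * (2 * V * (K * (2 * V * M)) + 2 * V).
apply: (@squeeze_cvge _ _ _ _ (cst 0%E) _ (fun delta => (C * delta)%:E)).
- near=> delta.
  have d0 : 0 < delta by near: delta; exact: nbhs_right_gt.
  have d1 : delta < 1 by near: delta; exact: nbhs_right_lt.
  have dd : delta < dbar by near: delta; exact: nbhs_right_lt.
  have d01 : 0 <= delta < 1 by rewrite ltW.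
  have ddbar : 0 <= delta < dbar by rewrite ltW.
  have Tc x : circle (perturbed_rotation theta S delta x).
    by apply: perturbation_circle => //; exact: rotation_circle.
  have [g [[gB mg] [gper g0] fE g1 gE]] := stationary_density nk
    (measurable_perturbed_rotation theta HS d01) Tc (f_probability _ ddbar)
    (f_fixed _ ddbar).
  have svard p := svar delta p d01.
  have := response_bound nk HS d01 gB mg gper gE HK g1 ms s1 svard d0 hA h0 hv.
  have -> : K * (2 * V * (K * (2 * delta * V * M)) + 2 * V * delta) = C * delta.
    by rewrite /C; ring.
  (* The chosen densities of [f delta] and of the Lebesgue measure agree with [g] and [1] almost
     everywhere. *)
  move=> bw; rewrite (@L1norm_ae _ _ (fun x => (g x - 1) / delta - h x)).
  + exact: L1norm_le.
  + by case: bw.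
  + have [_ aef] := density_ae (is_density_restr gB fE).
    have [_ ael] := density_ae (is_density_restr (bmf_cst 1) (@circle_lebE R)).
    apply: filterS2 aef ael => x fx lx cx.
    by rewrite (EFin_inj (fx cx)) (EFin_inj (lx cx)).
- exact: cvg_cst.
- apply/cvg_EFin; first exact: nearW.
  rewrite -[X in _ --> X](mulr0 C); apply: cvgMr.
  by apply: cvg_at_right_filter; exact: cvg_id.
Unshelve. all: by end_near. Qed.
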